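(* Let $\Gamma$ and $\Lambda$ be finitely generated amenable groups which are not virtually cyclic and let $\Gamma\stackrel{\alpha}{\curvearrowright}X$ and $\Lambda\stackrel{\beta}{\curvearrowright}Y$ be topologically free actions on compact metrizable spaces which are continuously orbit equivalent. Then $h_{\mathrm{top}}(\alpha)=h_{\mathrm{top}}(\beta)$.
   Context: Acting groups are discrete and act by homeomorphisms. An action is topologically free if the set of points with trivial stabilizer is dense. Actions $\Gamma\stackrel{\alpha}{\curvearrowright}X$ and $\Lambda\stackrel{\beta}{\curvearrowright}Y$ on compact metrizable spaces are continuously orbit equivalent if there are a homeomorphism $\Phi:X\to Y$ and continuous maps $\kappa:\Gamma\times X\to\Lambda$ and $\lambda:\Lambda\times Y\to\Gamma$ such that $\Phi(\alpha_tx)=\beta_{\kappa(t,x)}\Phi(x)$ and $\Phi^{-1}(\beta_hy)=\alpha_{\lambda(h,y)}\Phi^{-1}(y)$ for all $t\in\Gamma$, $x\in X$, $h\in\Lambda$, $y\in Y$. Topological entropy: for an action $\alpha$ of a countable amenable group $\Gamma$ on a compact metrizable space $X$ with compatible metric $d$, a finite set $F\subseteq\Gamma$, and $\varepsilon>0$, let $\mathrm{sep}_d(\alpha,F,\varepsilon)$ be the maximum cardinality of a set $A\subseteq X$ such that for all distinct $x,y\in A$ there is $s\in F$ with $d(\alpha_sx,\alpha_sy)>\varepsilon$. Then $h_{\mathrm{top}}(\alpha)=\sup_{\varepsilon>0}\limsup_{n\to\infty}\frac{1}{|F_n|}\log\mathrm{sep}_d(\alpha,F_n,\varepsilon)\in[0,\infty]$,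 where $(F_n)$ is a (left) F{\o}lner sequence for $\Gamma$; this does not depend on the choice of F{\o}lner sequence or compatible metric. *)

(* Defs.v *)
From HB Require Import structures.
From mathcomp Require Import all_boot all_order all_algebra finmap.
From mathcomp Require Import all_classical all_reals all_analysis.

Set Implicit Arguments.
Unset Strict Implicit.
Unset Printing Implicit Defensive.

Import Order.TTheory GRing.Theory Num.Theory.
Import numFieldNormedType.Exports.

Local Open Scope classical_set_scope.
Local Open Scope ring_scope.

Definition subgroup (G : groupType) (H : set G) : Prop :=
  [/\ H 1%g, forall x y, H x -> H y -> H (x * y)%g &
      forall x, H x -> H (x^-1)%g].

Definition generated_subgroup (G : groupType) (S : set G) : set G :=
  smallest (@subgroup G) S.

Definition finitely_generated (G : groupType) : Prop :=
  exists S : set G, finite_set S /\ generated_subgroup S = setT.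

Definition finite_index (G : groupType) (H : set G) : Prop :=
  finite_set (range (fun s : G => [set (s * x)%g | x in H])).

(* The cyclic subgroup may be trivial, so finite groups are virtually cyclic. *)
Definition virtually_cyclic (G : groupType) : Prop :=
  exists g : G, finite_index (generated_subgroup [set g]).

(* Amenability of a discrete group: a left-invariant finitely additive
   probability measure defined on all subsets. *)
Definition amenable (R : realType) (G : groupType) : Prop :=
  exists m : set G -> R,
    [/\ m setT = 1, forall A, 0 <= m A,
        forall A B, A `&` B = set0 -> m (A `|` B) = m A + m B &
        forall (s : G) A, m [set (s * x)%g | x in A] = m A].

Definition left_Folner (R : realType) (G : groupType) (F : nat -> {fset G}) :
    Prop :=
  (forall n, F n != fset0) /\
  forall s : G,
    (fun n => let sF := [fset (s * x)%g | x in F n]%fset in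
       #|` (sF `\` F n) `|` (F n `\` sF)|%fset%:R / #|` F n|%:R : R)
      @ \oo --> (0 : R).

Definition action_by_homeo (G : groupType) (X : topologicalType)
    (alpha : G -> X -> X) : Prop :=
  [/\ forall x, alpha 1%g x = x,
      forall s t x, alpha (s * t)%g x = alpha s (alpha t x) &
      forall s, continuous (alpha s)].

Definition topologically_free (G : groupType) (X : topologicalType)
    (alpha : G -> X -> X) : Prop :=
  dense [set x | forall s, alpha s x = x -> s = 1%g].

Definition continuously_orbit_equivalent (G L : groupType)
    (X Y : topologicalType) (alpha : G -> X -> X) (beta : L -> Y -> Y) : Prop :=
  exists (Phi : X -> Y) (Psi : Y -> X) (kappa : G * X -> L) (lambda : L * Y -> G),
    [/\ [/\ cancel Phi Psi, cancel Psi Phi, continuous Phi & continuous Psi],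
        continuous (kappa : discrete_topology G * X -> discrete_topology L),
        continuous (lambda : discrete_topology L * Y -> discrete_topology G),
        forall t x, Phi (alpha t x) = beta (kappa (t, x)) (Phi x) &
        forall h y, Psi (beta h y) = alpha (lambda (h, y)) (Psi y)].

Definition eps_separated (R : realType) (G : groupType) (X : metricType R)
    (alpha : G -> X -> X) (F : {fset G}) (eps : R) (A : {fset X}) : Prop :=
  forall x y, x \in A -> y \in A -> x != y ->
    exists2 s, s \in F & eps < mdist (alpha s x) (alpha s y).

(* On a compact space the supremum is a maximum. *)
Definition sep (R : realType) (G : groupType) (X : metricType R)
    (alpha : G -> X -> X) (F : {fset G}) (eps : R) : \bar R :=
  ereal_sup [set (#|` A|%:R)%:E | A in eps_separated alpha F eps].

(* The entropy is computed from the distance of [X] and the sequence [F]. *)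
Definition htop (R : realType) (G : groupType) (X : metricType R)
    (alpha : G -> X -> X) (F : nat -> {fset G}) : \bar R :=
  ereal_sup [set limn_esup
      (fun n => ((#|` F n|%:R)^-1)%:E * lne (sep alpha (F n) eps))%E
    | eps in [set eps : R | 0 < eps]].

(* Main.v *)
(* It suffices to bound the entropy of [beta] by that of [alpha].  By topological
   freeness the orbit equivalence gives, for each point [x], a bijection from
   Lambda to Gamma satisfying a cocycle identity, locally constant in [x] and
   with uniformly bounded displacement of the generators in both directions.

   For a finite subset [E] of Lambda suppose that a subtree [l] of the Cayley
   graph contains the boundary of [E].  There are at most [C ^ |l|] restrictions
   of these bijections to [l], and such a restriction determines the image [E']
   of [E] in Gamma, as well as the bijection on all of [E] along [E']-close
   orbits.  Hence a coloring into (alpha, E')-close classes for each restriction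
   yields a coloring into (beta, E)-close classes, at the cost of a factor
   [C ^ |l|].  The set [E'] is as invariant as [E], so by the Ornstein-Weiss
   quasi-tiling argument its number of colors is governed by the entropy of
   [alpha].

   It remains to make [|l| / |E|] small.  In a connected Folner set [E] choose a
   maximal separated net at scale [r]; joining its points by paths of length
   [2 r + 1] costs about [|E| (2 r + 1) / |B_r|], where [B_r] is the ball of
   radius [r].  This is small relative to [|E|] because a finitely generated
   group that is not virtually cyclic has superlinear growth. *)

Require Import Defs.
From mathcomp Require Import all_boot all_order all_algebra finmap.
From mathcomp Require Import all_classical all_reals all_analysis.
From mathcomp Require Import zify ring lra.

Local Open Scope classical_set_scope.

Import Order.TTheory GRing.Theory Num.Theory numFieldNormedType.Exports.
Set Implicit Arguments.
Unset Strict Implicit.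
Unset Printing Implicit Defensive.

(** * Quasi-tilings *)

Section Boundary.
Variable G : groupType.
Implicit Types (K A B D U : {fset G}).

(** A point at which some [t] in [K] changes membership in [A] lies in [A] or [K^-1 A]; naming this
    set makes the boundary finite. *)
Definition bdry K A : {fset G} :=
  [fset x in A `|` [fset (t^-1 * x)%g | t in K, x in A]
     | has (fun t => (t * x \in A)%g != (x \in A)) K]%fset.

Lemma in_bdry K A x :
  (x \in bdry K A) = has (fun t => (t * x \in A)%g != (x \in A)) K.
Proof.
rewrite !inE /=; apply/andb_idl => /hasP[t tK]; case: (boolP (x \in A)) => //= xA.
rewrite eqbF_neg negbK => txA; apply/imfset2P; exists t => //.
by exists (t * x)%g => //; rewrite mulKg.
Qed.

Lemma bdryP K A x :
  reflect (exists2 t, t \in K & (t * x \in A)%g != (x \in A)) (x \in bdry K A).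
Proof. by rewrite in_bdry; exact: hasP. Qed.

Lemma bdryS K K' A : (K `<=` K')%fset -> (bdry K A `<=` bdry K' A)%fset.
Proof.
move=> KK'; apply/fsubsetP => x /bdryP[t tK txA].
by apply/bdryP; exists t => //; exact: (fsubsetP KK').
Qed.

Lemma bdryD K A U : (bdry K (A `\` U) `<=` bdry K A `|` bdry K U)%fset.
Proof.
apply/fsubsetP => x /bdryP[t tK]; rewrite !in_fsetD in_fsetU => H.
apply/orP; case: (boolP ((t * x \in U)%g == (x \in U))) => [/eqP e|ne].
  left; apply/bdryP; exists t => //; move: H; rewrite e.
  by case: (x \in U).
by right; apply/bdryP; exists t.
Qed.

Lemma bdryU K A B : (bdry K (A `|` B) `<=` bdry K A `|` bdry K B)%fset.
Proof.
apply/fsubsetP => x /bdryP[t tK]; rewrite !in_fsetU => H.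
apply/orP; case: (boolP ((t * x \in B)%g == (x \in B))) => [/eqP e|ne].
  left; apply/bdryP; exists t => //; move: H; rewrite e.
  by case: (x \in B); rewrite ?orbT // !orbF.
by right; apply/bdryP; exists t.
Qed.

(** Right translation commutes with the left multiplications that define [bdry], so the tiles are
    right translates of one shape. *)
Definition rtrans A (c : G) : {fset G} := [fset (x * c)%g | x in A]%fset.

Lemma in_rtrans A c x : (x \in rtrans A c) = (x * c^-1 \in A)%g.
Proof.
apply/imfsetP/idP => [[y /= yA ->]|xA]; first by rewrite mulgK.
by exists (x * c^-1)%g => //; rewrite mulgVK.
Qed.

Lemma card_rtrans A c : #|` rtrans A c| = #|` A|.
Proof. by rewrite card_imfset //; exact: mulIg. Qed.

Lemma bdry_rtrans K A c : bdry K (rtrans A c) = rtrans (bdry K A) c.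
Proof.
apply/fsetP => x; rewrite in_rtrans !in_bdry; apply/eq_has => t /=.
by rewrite !in_rtrans mulgA.
Qed.

Lemma bdry0 K : bdry K fset0 = fset0.
Proof. by apply/fsetP => x; rewrite in_bdry !inE; apply/hasP => -[]. Qed.

Definition almost_inv (R : realType) K (d : R) A :=
  (#|` bdry K A|%:R <= d * #|` A|%:R)%R.

(* Greedy scan: a translate is kept when at most a fraction [e] of it is
   already covered, so kept translates are almost disjoint, whereas every
   candidate translate meets the union in a fraction at least [e]. *)
Lemma greedy_cover (R : realType) (e : R) D (cs : seq G) : (0 <= e <= 1)%R ->
  exists s : seq G, exists U : {fset G},
  [/\ {subset s <= cs}, U = (\bigcup_(c <- s) rtrans D c)%fset,
   ((1 - e) * #|` D|%:R * (size s)%:R <= #|` U|%:R)%R &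
   forall c, c \in cs -> (e * #|` D|%:R <= #|` rtrans D c `&` U|%fset%:R)%R].
Proof.
move=> /andP[e0 e1]; elim: cs => [|c cs [s [U [sU UE sz cov]]]].
  by exists [::], fset0; split => //; rewrite ?big_nil // mulr0.
have [le|lt] := lerP (e * #|` D|%:R)%R (#|` rtrans D c `&` U|%fset%:R)%R.
  exists s, U; split => // [x /sU|x]; first by rewrite inE orbC => ->.
  by rewrite inE => /predU1P[->|/cov].
exists (c :: s), (rtrans D c `|` U)%fset; split.
- by move=> x; rewrite !inE => /orP[->//|/sU ->]; rewrite orbT.
- by rewrite big_cons UE.
- have -> : #|` (rtrans D c `|` U)%fset| = (#|` U| + #|` (rtrans D c `\` U)%fset|)%N.
    by have := cardfsUI (rtrans D c) U; have := cardfsID U (rtrans D c); lia.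
  have := cardfsID U (rtrans D c); rewrite card_rtrans => /(congr1 (fun n => n%:R : R)%R).
  by rewrite /= natrD /= -[(size s).+1]add1n !natrD; nra.
- move=> x; rewrite inE => /predU1P[->|/cov].
    rewrite fsetIUr fsetIid (fsetUidPl _ _ _) ?fsubsetIl // card_rtrans.
    by rewrite ler_piMl.
  by move=> /le_trans; apply; rewrite ler_nat fsubset_leq_card // fsetIS // fsubsetUr.
Qed.

End Boundary.

(** * The Ornstein-Weiss estimate for monotone, subadditive, right-invariant set functions *)

Section OrnsteinWeiss.
Local Open Scope ring_scope.
Variables (R : realType) (G : groupType).
Implicit Types (K A B D U : {fset G}).

(** For a fixed [d] in [D] at most [|U|] centers [c] have [d * c] in [U], since [c] is recovered
    from [d * c]; exchanging the sums gives the bound. *)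
Lemma double_count (Cs D U : {fset G}) :
  (\sum_(c <- Cs) #|` (rtrans D c `&` U)%fset| <= #|` D| * #|` U|)%N.
Proof.
have E c : #|` (rtrans D c `&` U)%fset| = (\sum_(d <- D) (d * c \in U)%g)%N.
  have -> : (rtrans D c `&` U = rtrans [fset d in D | (d * c \in U)%g] c)%fset.
    by apply/fsetP => x; rewrite in_rtrans !inE /= in_rtrans mulgVK.
  rewrite card_rtrans card_fset_sum1 big_fset /= [LHS]big_mkcond.
  by apply: eq_bigr => d _; case: (_ \in U).
rewrite (eq_bigr _ (fun c _ => E c)) exchange_big /= card_fset_sum1 big_distrl /=.
apply: leq_sum => d _; rewrite mul1n.
have -> : (\sum_(c <- Cs) (d * c \in U)%g)%N = #|` [fset c in Cs | (d * c \in U)%g]%fset|.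
  rewrite card_fset_sum1 big_fset /= [RHS]big_mkcond.
  by apply: eq_bigr => c _; case: (_ \in U).
set S := [fset c in Cs | _]%fset.
have <- : #|` [fset (d * c)%g | c in S]%fset| = #|` S| by rewrite card_imfset //; exact: mulgI.
apply: fsubset_leq_card.
by apply/fsubsetP => _ /imfsetP[c /= + ->]; rewrite !inE => /andP[].
Qed.

Variable f : {fset G} -> R.
Hypothesis f0 : f fset0 = 0%R.
Hypothesis f_sub : forall A B, (f (A `|` B)%fset <= f A + f B)%R.
Hypothesis f_mono : forall A B, (A `<=` B)%fset -> (f A <= f B)%R.
Hypothesis f_inv : forall A c, f (rtrans A c) = f A.

Lemma f_bigcup D (s : seq G) : (f (\bigcup_(c <- s) rtrans D c)%fset <= (size s)%:R * f D)%R.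
Proof.
elim: s => [|c s IH] /=; first by rewrite big_nil f0 mul0r.
rewrite big_cons -add1n natrD mulrDl mul1r.
by apply: le_trans (f_sub _ _) _; rewrite f_inv lerD2l.
Qed.

Lemma f_le_card A : (f A <= f [fset 1%g]%fset * #|` A|%:R)%R.
Proof.
have E : (A = \bigcup_(c <- A) rtrans [fset 1%g] c)%fset.
  apply/fsetP => x; apply/idP/bigfcupP => [xA|[c]].
    by exists x; rewrite ?xA // in_rtrans mulgV inE.
  by rewrite andbT => cA; rewrite in_rtrans inE => /eqP /(canRL (mulgVK c)) ->; rewrite mul1g.
by rewrite {1}E mulrC; apply: f_bigcup.
Qed.

Lemma f_ge0 A : (0 <= f A)%R.
Proof. by rewrite -f0 f_mono // fsub0set. Qed.

Lemma bdry_bigcup K D (s : seq G) :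
  (#|` bdry K (\bigcup_(c <- s) rtrans D c)%fset| <= size s * #|` bdry K D|)%N.
Proof.
elim: s => [|c s IH] /=; first by rewrite big_nil bdry0 cardfs0.
rewrite big_cons mulSn; apply: leq_trans (fsubset_leq_card (bdryU _ _ _)) _.
by apply: leq_trans (leq_card_fsetU _ _) _; rewrite bdry_rtrans card_rtrans leq_add2l.
Qed.

(** One round of tiling: [A1] is what remains of [A] after removing the union [U] of greedily chosen
    translates of [D] inside [A]. The kept translates have total size at most [|U| / (1 - e)],
    whence this factor in the bounds on [f] and on the boundary. *)
Lemma quasi_tiling_step (e d c : R) K D A : (0 < e < 1)%R -> (0 <= d)%R ->
  D != fset0 -> almost_inv K d D -> (f D <= c * #|` D|%:R)%R ->
  exists A1, [/\ (A1 `<=` A)%fset,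
    (f A <= f A1 + c / (1 - e) * (#|` A|%:R - #|` A1|%:R))%R,
    (#|` A1|%:R <= (1 - e) * #|` A|%:R + e * #|` bdry D A|%:R)%R &
    (#|` bdry K A1|%:R <= #|` bdry K A|%:R + d / (1 - e) * #|` A|%:R)%R].
Proof.
move=> /andP[e0 e1] d0 D0 invD fD.
have e2 : (0 < 1 - e)%R by rewrite subr_gt0.
have Dp : (0 < #|` D|%:R :> R)%R by rewrite ltr0n cardfs_gt0.
have c0 : (0 <= c)%R by rewrite -(pmulr_lge0 _ Dp) (le_trans (f_ge0 _) fD).
pose Cs := [fset x in A | all (fun t => (t * x \in A)%g) D]%fset.
have [|s [U [sCs UE sz cov]]] := @greedy_cover G R e D (enum_fset Cs).
  by rewrite !ltW.
have UA : (U `<=` A)%fset.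
  rewrite UE; apply/fsubsetP => x /bigfcupP[y]; rewrite andbT => /sCs.
  rewrite !inE /= => /andP[_ /allP yA]; rewrite in_rtrans => /yA.
  by rewrite mulgVK.
(* Each candidate translate meets [U] in at least [e |D|] points, while by [double_count] these
   intersections have total size at most [|D| |U|]. *)
have cU : (e * #|` Cs|%:R <= #|` U|%:R)%R.
  rewrite -(ler_pM2l Dp) -natrM.
  apply: (@le_trans _ _ (\sum_(c <- Cs) #|` (rtrans D c `&` U)%fset|)%N%:R); last first.
    by rewrite ler_nat double_count.
  rewrite [#|` Cs|]card_fset_sum1 !natr_sum !mulr_sumr.
  rewrite big_seq [leRHS]big_seq; apply: ler_sum => x /cov.
  by rewrite mulr1 mulrC.
have cC : (#|` A|%:R <= #|` Cs|%:R + #|` bdry D A|%:R :> R)%R.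
  rewrite -natrD ler_nat; apply: leq_trans (leq_card_fsetU _ _).
  apply: fsubset_leq_card; apply/fsubsetP => x xA; rewrite in_fsetU.
  have -> : (x \in Cs) = all (fun t => (t * x \in A)%g) D by rewrite !inE /= xA.
  case: (boolP (all _ _)) => //= /allPn[t tD txA].
  by apply/bdryP; exists t; rewrite // xA (negbTE txA).
have cA : (#|` (A `\` U)%fset|%:R = #|` A|%:R - #|` U|%:R :> R)%R.
  by rewrite cardfsDS // natrB // fsubset_leq_card.
have bU : ((1 - e) * #|` bdry K U|%:R <= d * #|` U|%:R)%R.
  rewrite UE; apply: (@le_trans _ _ ((1 - e) * ((size s)%:R * (d * #|` D|%:R)))%R).
    rewrite ler_pM2l // -UE; apply: (@le_trans _ _ ((size s)%:R * #|` bdry K D|%:R)%R).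
      by rewrite -natrM ler_nat UE bdry_bigcup.
    by apply: ler_wpM2l.
  rewrite -UE; apply: (@le_trans _ _ (d * ((1 - e) * #|` D|%:R * (size s)%:R))%R).
    by rewrite le_eqVlt; apply/orP; left; apply/eqP; ring.
  exact: ler_wpM2l.
exists (A `\` U)%fset; split; first exact: fsubsetDl.
- rewrite cA opprB addrCA subrr addr0 -(ler_pM2l e2).
  have fU : (f U <= (size s)%:R * (c * #|` D|%:R))%R.
    by rewrite UE; apply: le_trans (f_bigcup _ _) _; rewrite ler_wpM2l.
  have : (f A <= f (A `\` U)%fset + f U)%R.
    by apply: le_trans (f_sub _ _); apply: f_mono; apply/fsubsetP => x xA;
    rewrite in_fsetU in_fsetD xA andbT orNb.
  have -> : ((1 - e) * (f (A `\` U)%fset + c / (1 - e) * #|` U|%:R) =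
    (1 - e) * f (A `\` U)%fset + c * #|` U|%:R)%R by field; rewrite gt_eqF.
  nra.
- rewrite cA; nra.
- apply: (@le_trans _ _ (#|` bdry K A|%:R + #|` bdry K U|%:R)%R).
    by rewrite -natrD ler_nat (leq_trans (fsubset_leq_card (bdryD _ _ _))) ?leq_card_fsetU.
  rewrite lerD2l -(ler_pM2l e2).
  have -> : ((1 - e) * (d / (1 - e) * #|` A|%:R) = d * #|` A|%:R)%R.
    by field; rewrite gt_eqF.
  apply: le_trans bU _; rewrite ler_wpM2l // ler_nat; exact: fsubset_leq_card.
Qed.

(** The shapes are chosen in reverse order of use: [K0] governs the later rounds, so [D], which is
    used first, is taken almost invariant under [K0], and removing its translates adds little
    [K0]-boundary. Each round shrinks the remainder by a factor close to [1 - e]. *)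
Lemma iterated_tiling (c e : R) : 0 < e < 1 -> 0 <= c ->
  (forall K (d : R), 0 < d -> exists D, [/\ D != fset0, almost_inv K d D & f D <= c * #|` D|%:R]) ->
  forall n (g : R), 0 < g -> exists K, forall A, exists A1, [/\ (A1 `<=` A)%fset,
    f A <= f A1 + c / (1 - e) * (#|` A|%:R - #|` A1|%:R) &
    #|` A1|%:R <= ((1 - e) ^+ n + g) * #|` A|%:R + n.+1%:R * #|` bdry K A|%:R].
Proof.
move=> /[dup] e01 /andP[e0 e1] c0 HD; have e2 : 0 < 1 - e by rewrite subr_gt0.
elim=> [|n IH] g g0.
  exists fset0 => A; exists A; split => //; first by rewrite subrr mulr0 addr0.
  have : 0 <= #|` A|%:R :> R by []; have : 0 <= #|` bdry fset0 A|%:R :> R by [].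
  by rewrite expr0; nra.
have g2 : 0 < g / 2 by rewrite divr_gt0.
have [K0 HK0] := IH _ g2.
(* The boundary created in the first round is weighted by [n.+1] in the bound for the later ones;
   this [d] makes its contribution [g / 2 * |A|]. *)
pose d := (g / 2) * (1 - e) / n.+1%:R.
have dp : 0 < d by rewrite divr_gt0 // mulr_gt0.
have [D [D0 invD fD]] := HD K0 d dp.
exists (K0 `|` D)%fset => A.
have [A1 [A1A fA cA1 bA1]] := quasi_tiling_step A e01 (ltW dp) D0 invD fD.
have [A2 [A2A fA1 cA2]] := HK0 A1.
exists A2; split; first exact: fsubset_trans A2A A1A.
  have := lerD fA fA1; lra.
have b0 : #|` bdry K0 A|%:R <= #|` bdry (K0 `|` D)%fset A|%:R :> R.
  by rewrite ler_nat fsubset_leq_card // bdryS // fsubsetUl.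
have b1 : #|` bdry D A|%:R <= #|` bdry (K0 `|` D)%fset A|%:R :> R.
  by rewrite ler_nat fsubset_leq_card // bdryS // fsubsetUr.
have cA : #|` A1|%:R <= #|` A|%:R :> R by rewrite ler_nat fsubset_leq_card.
have dE : n.+1%:R * (d / (1 - e) * #|` A|%:R) = g / 2 * #|` A|%:R.
  by rewrite /d; field; rewrite gt_eqF //= addrC natr1 pnatr_eq0.
have n0 : 0 <= n.+1%:R :> R by [].
have := ler_wpM2l n0 (le_trans bA1 (lerD b0 (lexx _))); rewrite mulrDr dE => H1.
set b := #|` bdry (K0 `|` D)%fset A|%:R in b0 b1 H1 *.
have p0 : 0 <= (1 - e) ^+ n by rewrite exprn_ge0 // ltW.
have p1 : (1 - e) ^+ n <= 1 by rewrite exprn_ile1 ?ltW //; lra.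
have H2 : (1 - e) ^+ n * #|` A1|%:R <= (1 - e) ^+ n.+1 * #|` A|%:R + b.
  have bge0 : 0 <= b by [].
  apply: (@le_trans _ _ ((1 - e) ^+ n * ((1 - e) * #|` A|%:R + b))).
    rewrite ler_wpM2l //; apply: le_trans cA1 _; rewrite lerD2l.
    by apply: le_trans (ler_wpM2l (ltW e0) b1) _; rewrite ler_piMl // ltW.
  by rewrite mulrDr mulrA -exprSr lerD2l ler_piMl.
have H3 : g / 2 * #|` A1|%:R <= g / 2 * #|` A|%:R by rewrite ler_pM2l.
rewrite -[n.+2%:R]natr1; lra.
Qed.

Theorem ornstein_weiss (c eta : R) : 0 <= c -> 0 < eta ->
  (forall K (d : R), 0 < d -> exists D, [/\ D != fset0, almost_inv K d D & f D <= c * #|` D|%:R]) ->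
  exists K (d : R), 0 < d /\ forall A, almost_inv K d A -> f A <= (c + eta) * #|` A|%:R.
Proof.
move=> c0 eta0 HD.
(* This [e] gives [c / (1 - e) <= c + eta / 2]; the other half of [eta] pays for the uncovered
   part. *)
pose e := eta / (2 * c + 2 * eta).
have den : 0 < 2 * c + 2 * eta by lra.
have e0 : 0 < e by rewrite divr_gt0.
have ee : e * (2 * c + 2 * eta) = eta by rewrite /e mulfVK // gt_eqF.
have e1 : e < 1 by nra.
have e2 : 0 < 1 - e by rewrite subr_gt0.
have ce : c / (1 - e) <= c + eta / 2 by rewrite ler_pdivrMr //; nra.
pose M := f [fset 1%g]%fset; have M0 : 0 <= M := f_ge0 _.
(* The remainder will have at most [3 * g * |A|] points, one [g] each from the power of [1 - e], the
   tiling error and the boundary, and [f] costs at most [M] per point. *)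
pose g := eta / (6 * (M + 1)).
have g0 : 0 < g by rewrite divr_gt0 //; lra.
have gE : 6 * (M + 1) * g = eta by rewrite /g mulrC mulfVK // gt_eqF //; lra.
have [n hn] : exists n, (1 - e) ^+ n <= g.
  have : (fun n => (1 - e) ^+ n) @ \oo --> (0 : R).
    by apply: cvg_expr; rewrite ger0_norm ?ltW //; lra.
  move=> /cvgrPdist_le /(_ _ g0) [N _ /(_ N (leqnn N))] /=; rewrite sub0r normrN => H.
  by exists N; apply: le_trans H; rewrite ler_norm.
have e01 : 0 < e < 1 by rewrite e0 e1.
have [K HK] := iterated_tiling e01 c0 HD n g0.
exists K, (g / n.+1%:R); split; first by rewrite divr_gt0.
move=> A; rewrite /almost_inv => invA; have [A1 [A1A fA cA1]] := HK A.
have := ler_wpM2l (ler0n R n.+1) invA.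
have -> : n.+1%:R * (g / n.+1%:R * #|` A|%:R) = g * #|` A|%:R.
  by field; rewrite addrC natr1 pnatr_eq0.
move=> H; have A0 : 0 <= #|` A|%:R :> R by [].
have cA : #|` A1|%:R <= #|` A|%:R :> R by rewrite ler_nat fsubset_leq_card.
have fA1 := f_le_card A1; rewrite -/M in fA1.
have H1 : #|` A1|%:R <= 3 * g * #|` A|%:R.
  have := ler_wpM2r A0 hn; lra.
have H2 := ler_wpM2l M0 H1.
have H3 : M * (3 * g * #|` A|%:R) <= eta / 2 * #|` A|%:R.
  rewrite mulrA ler_wpM2r //; nra.
have H4 : c / (1 - e) * (#|` A|%:R - #|` A1|%:R) <= (c + eta / 2) * #|` A|%:R.
  apply: (@le_trans _ _ ((c + eta / 2) * (#|` A|%:R - #|` A1|%:R))).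
    by rewrite ler_wpM2r // subr_ge0.
  by rewrite ler_wpM2l // ?gerBl //; lra.
lra.
Qed.

End OrnsteinWeiss.

(** * Growth of groups that are not virtually cyclic *)

Section WordBalls.
Local Open Scope nat_scope.
Variable G : groupType.
Implicit Types (T A : {fset G}).

(* Connectedness of the left Cayley graph of [T]. *)
Definition generates T := forall A : set G, A 1%g ->
  (forall t x, t \in T -> A x -> A (t * x)%g) -> forall x, A x.

(** Products of exactly [n] letters; this is the ball of radius [n] once [T] contains the
    identity. *)
Fixpoint wball T (n : nat) : {fset G} :=
  if n is m.+1 then [fset (t * x)%g | t in T, x in wball T m]%fset
  else [fset 1%g]%fset.

Arguments wball : simpl never.

Lemma wballSP T n x :
  reflect (exists2 t, t \in T & exists2 y, y \in wball T n & x = (t * y)%g)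
    (x \in wball T n.+1).
Proof. exact: imfset2P. Qed.

Lemma in_wball0 T x : (x \in wball T 0) = (x == 1%g).
Proof. by rewrite in_fset1. Qed.

Lemma wballD T m n x y :
  x \in wball T m -> y \in wball T n -> (x * y)%g \in wball T (m + n).
Proof.
elim: m x => [|m IH] x; first by rewrite in_wball0 => /eqP -> yb; rewrite mul1g.
move=> /wballSP[t tT [z zb ->]] yb; rewrite -mulgA addSn.
by apply/wballSP; exists t => //; exists (z * y)%g => //; exact: IH.
Qed.

Lemma wball1 T t : t \in T -> t \in wball T 1.
Proof.
by move=> tT; apply/wballSP; exists t => //; exists 1%g; rewrite ?in_wball0 ?mulg1.
Qed.

Lemma wballX T m x k : x \in wball T m -> (x ^+ k)%g \in wball T (k * m).
Proof.
move=> xb; elim: k => [|k IH]; first by rewrite expg0 in_wball0.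
by rewrite expgS mulSn wballD.
Qed.

Section Symmetric.
Variable T : {fset G}.
Hypothesis T1 : 1%g \in T.
Hypothesis TV : forall t, t \in T -> (t^-1)%g \in T.
Hypothesis Tgen : generates T.

Lemma wball_le m n : (m <= n)%N -> (wball T m `<=` wball T n)%fset.
Proof.
move=> /subnKC <-; elim: (n - m)%N => [|k IH]; first by rewrite addn0.
apply: fsubset_trans IH _; rewrite addnS; apply/fsubsetP => x xb.
by apply/wballSP; exists 1%g => //; exists x; rewrite ?mul1g.
Qed.

Lemma wball_id n : 1%g \in wball T n.
Proof. by apply: (fsubsetP (wball_le (leq0n n))); rewrite in_wball0. Qed.

Lemma wballV n x : x \in wball T n -> (x^-1)%g \in wball T n.
Proof.
elim: n x => [|n IH] x; first by rewrite !in_wball0 => /eqP ->; rewrite invg1.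
move=> /wballSP[t tT [y yb ->]]; rewrite invgM -addn1; apply: wballD; first exact: IH.
exact/wball1/TV.
Qed.

Lemma wball_exhaust x : exists n, x \in wball T n.
Proof.
apply: (Tgen (A := [set x | exists n, x \in wball T n])) => [|t y tT [n yb]].
  by exists 0%N; rewrite in_wball0.
by exists n.+1; apply/wballSP; exists t => //; exists y.
Qed.

Definition word (w : seq G) := all (fun t => t \in T) w.

Definition weval (w : seq G) : G := foldr (fun x y => (x * y)%g) 1%g w.

(* The number written by [w] in base [#|` T|]; at fixed length it orders the
   words lexicographically. *)
Fixpoint wval (w : seq G) : nat :=
  if w is t :: w' then index t T * #|` T| ^ size w' + wval w' else 0.

(** The shortlex normal forms. Unlike a geodesic, such a word is determined by its value, so equal
    values give equal words. *)
Definition good (w : seq G) := word w /\ forall w', word w' ->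
  weval w' = weval w -> size w' <= size w ->
  size w' = size w /\ wval w <= wval w'.

Lemma weval_cat v w : weval (v ++ w) = (weval v * weval w)%g.
Proof. by elim: v => [|t v IH] /=; rewrite ?mul1g // IH mulgA. Qed.

Lemma wval_cat v w : wval (v ++ w) = wval v * #|` T| ^ size w + wval w.
Proof.
elim: v => [|t v IH] //=.
by rewrite IH size_cat expnD mulnDl mulnA addnA.
Qed.

Lemma wval_lt w : word w -> wval w < #|` T| ^ size w.
Proof.
elim: w => [|t w IH] //= /andP[tT /IH lt]; rewrite expnS.
have : index t T < #|` T| by rewrite index_mem.
move: (#|` T|) (index t T) (_ ^ _) lt => a i b; nia.
Qed.

Lemma wval_inj v w : word v -> word w -> size v = size w -> wval v = wval w -> v = w.
Proof.
elim: v w => [|t v IH] [|u w] //= /andP[tT wv] /andP[uT ww] [sz] e.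
have lv := wval_lt wv; have lw := wval_lt ww; rewrite sz in e lv.
have ei : index t T = index u T.
  by move: e lv lw; move: (index t T) (index u T) (_ ^ _) => a b k; nia.
rewrite ei in e; move/addnI: e => /(IH _ wv ww sz) ->.
by rewrite -(nth_index 1%g tT) ei nth_index.
Qed.

(** At fixed length [wval] is positional, so a better word for the factor would give a better word
    for the whole. *)
Lemma good_factor a v b : good (a ++ v ++ b) -> good v.
Proof.
move=> [wd mn]; move: (wd); rewrite /word !all_cat => /and3P[wa wv wb].
split => // w' ww' ev sz.
have [] := mn (a ++ w' ++ b).
- by rewrite /word !all_cat wa wb; move: ww'; rewrite /word => ->.
- by rewrite !weval_cat ev.
- by rewrite !size_cat leq_add2l leq_add2r.
rewrite !size_cat !wval_cat !size_cat => /addnI/addIn e le; split => //; move: le;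
  rewrite e leq_add2l leq_add2r leq_pmul2r //.
by rewrite expn_gt0 cardfs_gt0; apply/orP; left; apply/fset0Pn; exists 1%g.
Qed.

Lemma word_wball n x :
  x \in wball T n <-> exists w, [/\ word w, size w = n & weval w = x].
Proof.
elim: n x => [|n IH] x.
  rewrite in_wball0; split => [/eqP ->|[[|t w] [] //= _ _ <-]]; last exact: eqxx.
  by exists [::].
split=> [/wballSP[t tT [y /IH[w [ww sw <-]] ->]]|[[|t w] [] //= /andP[tT ww] [sw] <-]].
  by exists (t :: w); rewrite /= tT sw.
by apply/wballSP; exists t => //; exists (weval w) => //; apply/IH; exists w.
Qed.

Lemma good_exists x : exists2 w, good w & weval w = x.
Proof.
pose P n := `[< exists w, [/\ word w, size w = n & weval w = x] >].
have exP : exists n, P n.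
  by have [n /word_wball H] := wball_exhaust x; exists n; apply/asboolP.
case: (ex_minnP exP) => n /asboolP Pn minn.
pose Q k := `[< exists w, [/\ word w, size w = n, weval w = x & wval w = k] >].
have exQ : exists k, Q k.
  by have [w [ww sw ew]] := Pn; exists (wval w); apply/asboolP; exists w.
case: (ex_minnP exQ) => k /asboolP[w [ww sw ew vw]] mink.
exists w => //; split => // w' ww' ew' sw'.
have e : size w' = size w.
  apply/eqP; rewrite eqn_leq sw' sw minn //; apply/asboolP; exists w'.
  by rewrite ew' ew.
by split=> //; rewrite vw mink //; apply/asboolP; exists w'; rewrite e sw ew' ew.
Qed.

Lemma good_wball n w : good w -> n < size w -> weval w \notin wball T n.
Proof.
move=> [ww mn] lt; apply/negP => /word_wball[w' [ww' sw' ew']].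
have [|e _] := mn w' ww' ew'; first by rewrite sw' ltnW.
by rewrite -sw' e ltnn in lt.
Qed.

Lemma good_eval_inj v w : good v -> good w -> size v = size w ->
  weval v = weval w -> v = w.
Proof.
move=> [wv mv] [ww mw] sz e; apply: wval_inj => //; apply/eqP; rewrite eqn_leq.
by have [|_ ->] := mv w ww (esym e); rewrite ?sz //; have [|_ ->] := mw v wv e; rewrite ?sz.
Qed.

Lemma finite_of_ball n : [set: G] `<=` [set` wball T n] -> finite_set [set: G].
Proof. by move=> /sub_finite_set; apply; exact: finite_fset. Qed.

Lemma good_of_size n : infinite_set [set: G] -> exists2 w, good w & size w = n.
Proof.
move=> inf; have [x xn] : exists x, x \notin wball T n.
  apply: contrapT => /forallNP H; apply: inf; apply: (@finite_of_ball n) => x _ /=.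
  by have /negP := H x; rewrite negbK.
have [w gw ew] := good_exists x.
have sw : n < size w.
  rewrite ltnNge; apply/negP => le; move/negP: xn; apply; rewrite -ew.
  by apply: (fsubsetP (wball_le le)); apply/word_wball; exists w; case: gw.
exists (take n w); last by rewrite size_takel // ltnW.
by apply: (@good_factor [::] _ (drop n w)); rewrite cat0s cat_take_drop.
Qed.

(* A good word all of whose factors of length [L] lie in a sphere with at most
   [C] elements has two equal ones among its first [C.+1] factors, hence an
   initial period at most [C] along more than [L] letters. *)
Lemma good_power C L : infinite_set [set: G] ->
  #|` (wball T L.+1 `\` wball T L)%fset| <= C ->
  forall m, m * C <= L.+1 -> exists u,
    [/\ 0 < size u, size u <= C & good (flatten (nseq m u))].
Proof.
move=> inf cS m mC; have [w gw sw] := good_of_size (L.+1 + C) inf.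
pose fac i := take L.+1 (drop i w).
have sfac i : i <= C -> size (fac i) = L.+1.
  by move=> iC; rewrite size_takel // size_drop sw; lia.
have gfac i k : good (take k (drop i w)).
  apply: (@good_factor (take i w) _ (drop k (drop i w))).
  by rewrite !cat_take_drop.
have facS i : i <= C -> weval (fac i) \in (wball T L.+1 `\` wball T L)%fset.
  move=> iC; have gf : good (fac i) := gfac i L.+1.
  rewrite in_fsetD good_wball //; last by rewrite sfac.
  rewrite /=; apply/word_wball.
  by exists (fac i); rewrite sfac //; split => //; case: gf.
have [i [j [ij jC eij]]] : exists i j, [/\ i < j, j <= C & fac i = fac j].
  apply: contrapT => nex.
  have leC (k : 'I_C.+1) : k <= C by rewrite -ltnS.
  have inj : injective (fun i : 'I_C.+1 => weval (fac i)).
    move=> i j e; apply/val_inj/eqP; case: (ltngtP i j) => // lt; exfalso; apply: nex.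
      exists (val i), (val j); split => //; first exact: leC.
      by apply: good_eval_inj => //; [exact: gfac|exact: gfac|rewrite !sfac ?leC].
    exists (val j), (val i); split => //; first exact: leC.
    by apply: good_eval_inj => //; [exact: gfac|exact: gfac|rewrite !sfac ?leC].
  have : size [seq weval (fac (val k)) | k <- enum 'I_C.+1] <= C.
    apply: leq_trans cS; apply: uniq_leq_size; first by rewrite map_inj_uniq // enum_uniq.
    by move=> _ /mapP[k _ ->]; apply: facS; exact: leC.
  by rewrite size_map size_enum_ord ltnn.
pose u := take (j - i) (drop i w).
have su : size u = j - i by rewrite size_takel // size_drop sw; lia.
exists u; rewrite su; split; [by lia|by lia|].
(* Equality of the factors at [i] and [j] gives [w] the period [j - i] along the [L.+1 + (j - i)]
   letters that start at [i]. *)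
suff H k : k * (j - i) <= L.+1 + (j - i) -> take (k * (j - i)) (drop i w) = flatten (nseq k u).
  by rewrite -H; [exact: gfac|nia].
elim: k => [|k IH] kL; first by rewrite take0.
have kL' : k * (j - i) <= L.+1 by rewrite mulSn in kL; lia.
have dE : drop i w = u ++ drop j w.
  by rewrite -{1}(cat_take_drop (j - i) (drop i w)) drop_drop subnK // ltnW.
rewrite {1}dE take_cat su mulSn ltnNge leq_addr /= addKn; congr (_ ++ _).
rewrite -IH; last by lia.
have := congr1 (take (k * (j - i))) eij; rewrite /fac !take_takel // => ->.
Qed.

Lemma weval_nseq m u : weval (flatten (nseq m u)) = (weval u ^+ m)%g.
Proof. by elim: m => [|m IH] //=; rewrite weval_cat IH expgS. Qed.

Lemma size_flatten_nseq m (u : seq G) : size (flatten (nseq m u)) = m * size u.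
Proof. by rewrite size_flatten /shape map_nseq sumn_nseq mulnC. Qed.

(** If every sphere from radius [N] on had more than [c.*2] elements, the balls would grow by at
    least [c.*2.+1] per step, faster than the slope [c.*2] of the linear bound. *)
Lemma bounded_sphere c : (forall r, #|` wball T r| <= c * r.*2.+1) ->
  forall N, exists2 n, N <= n & #|` (wball T n.+1 `\` wball T n)%fset| <= c.*2.
Proof.
move=> lin N; apply: contrapT => /forall2NP H.
have {}H n : N <= n -> c.*2 < #|` (wball T n.+1 `\` wball T n)%fset|.
  by move=> Nn; case: (H n) => // /negP; rewrite -ltnNge.
have grow k : k * c.*2.+1 <= #|` wball T (N + k)|.
  elim: k => [|k IH] //; rewrite addnS mulSn.
  have := cardfsDS (wball_le (leqnSn (N + k))).
  have := fsubset_leq_card (wball_le (leqnSn (N + k))).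
  by have := H (N + k) (leq_addr _ _); lia.
(* After [k] steps the surplus of one element per step exceeds the constant term [c * N.*2.+1] of
   the bound. *)
set k := (c * N.*2.+1).+1; have := leq_trans (grow k) (lin _).
have -> : c * (N + k).*2.+1 = c * N.*2.+1 + k * c.*2 by lia.
by rewrite mulnS /k; lia.
Qed.

(* If all short elements had finite order, their orders would be bounded, but
   linear growth makes arbitrarily high powers of short words geodesic. *)
Lemma infinite_order_of_linear_growth c : infinite_set [set: G] ->
  (forall r, #|` wball T r| <= c * r.*2.+1) ->
  exists g : G, forall k, 0 < k -> (g ^+ k)%g != 1%g.
Proof.
move=> inf lin; apply: contrapT => /forallNP tors.
have tor (g : G) : exists2 k, 0 < k & (g ^+ k)%g = 1%g.
  apply: contrapT => H; case: (tors g) => k k0; apply/eqP => e; apply: H.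
  by exists k.
have [M HM] : exists M, forall g : G, g \in enum_fset (wball T c.*2) ->
    exists2 k, 0 < k <= M & (g ^+ k)%g = 1%g.
  elim: (enum_fset _) => [|g s [M HM]]; first by exists 0.
  have [k k0 gk] := tor g; exists (maxn M k) => h; rewrite inE => /predU1P[->|/HM].
    by exists k; rewrite // k0 leq_maxr.
  by move=> [k' /andP[k'0 k'M] e]; exists k'; rewrite // k'0 leq_max k'M.
(* This radius leaves room for the [M]-th power of a period of length at most [c.*2]. The value of
   the period has order at most [M], so some power of it is a nonempty good word for the
   identity. *)
have [n Mn cS] := bounded_sphere lin (M * c.*2).
have [//|u [u0 uc gu]] := good_power inf cS (m := M) _; first exact: leqW.
have wu : word u -> exists2 k, 0 < k <= M & (weval u ^+ k)%g = 1%g.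
  move=> wu; apply: HM; apply: (fsubsetP (wball_le uc)); apply/word_wball.
  by exists u.
case: (posnP M) => [M0|Mp].
  have /HM [k] : (1%g : G) \in enum_fset (wball T c.*2) by exact: wball_id.
  by rewrite M0; case: k.
have gk k : k <= M -> good (flatten (nseq k u)).
  move=> kM; move: gu; rewrite -(subnKC kM) nseqD flatten_cat.
  exact: (@good_factor [::]).
have [|k /andP[k0 /gk [_ gkm]] e] := wu.
  by have [] := gk 1 Mp; rewrite /= cats0.
have [] := gkm [::] => //; first by rewrite weval_nseq e.
by rewrite size_flatten_nseq => /esym/eqP; rewrite muln_eq0 !gtn_eqF.
Qed.

Definition gen1 (g : G) := generated_subgroup [set g].

Lemma gen1_subgroup g : subgroup (gen1 g).
Proof.
split.
- by move=> A [[]].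
- by move=> x y Hx Hy A [sA gA]; have [_ + _] := sA; apply; [exact: Hx|exact: Hy].
- by move=> x Hx A [sA gA]; have [_ _] := sA; apply; exact: Hx.
Qed.

Lemma gen1_id g : gen1 g g.
Proof. by move=> A [_]; apply. Qed.

Lemma gen1X g k : gen1 g (g ^+ k)%g.
Proof.
have [H1 HM _] := gen1_subgroup g.
by elim: k => [|k IH]; [rewrite expg0|rewrite expgS; apply: HM => //; exact: gen1_id].
Qed.

(** If radius [n.+1] met no new coset of [<g>], the finitely many cosets already found would be
    permuted into each other by the generators, hence cover [G], and [<g>] would have finite
    index. *)
Lemma many_cosets g n : ~ virtually_cyclic G -> exists s : seq G,
  [/\ size s = n.+1, {subset s <= wball T n} &
   forall i j, i <= n -> j <= n -> gen1 g ((nth 1 s i)^-1 * nth 1 s j)%g -> i = j].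
Proof.
move=> nvc; elim: n => [|n [s [sz sb sH]]].
  exists [:: 1%g]; split => // [x|[|?] [|?] //].
  by rewrite inE in_wball0.
have [H1 HM HV] := gen1_subgroup g.
have [y yb Hy] : exists2 y, y \in wball T n.+1 &
    forall i, i <= n -> ~ gen1 g ((nth 1 s i)^-1 * y)%g.
  apply: contrapT => nex; apply: nvc; exists g.
  have cov y : y \in wball T n.+1 -> exists2 i, i <= n & gen1 g ((nth 1 s i)^-1 * y)%g.
    move=> yb; apply: contrapT => /forall2NP H; apply: nex; exists y => // i iN Hi.
    by case: (H i).
  have {}cov x : exists2 i, i <= n & gen1 g ((nth 1 s i)^-1 * x)%g.
    move: x; apply: Tgen => [|t x tT [i iN Hi]]; first exact/cov/wball_id.
    have /cov[j jN Hj] : (t * nth 1 s i)%g \in wball T n.+1.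
      apply/wballSP; exists t => //; exists (nth 1 s i)%g => //.
      by rewrite sb // mem_nth // sz.
    exists j => //; have := HM _ _ Hj Hi.
    by rewrite -!mulgA mulVKg.
  apply: (@sub_finite_set _ _
    [set [set (nth 1 s i * x)%g | x in gen1 g] | i in `I_n.+1]); last first.
    exact/finite_image/finite_II.
  move=> _ [x _ <-]; have [i iN Hi] := cov x; exists i; first by rewrite /= ltnS.
  apply/seteqP; split => _ [h Hh <-].
    exists (((nth 1 s i)^-1 * x)^-1 * h)%g.
      by apply: HM => //; exact: HV.
    by rewrite invgM invgK !mulgA mulgV mul1g.
  exists ((nth 1 s i)^-1 * x * h)%g; first exact: HM.
  by rewrite !mulgA mulgV mul1g.
exists (rcons s y); split; first by rewrite size_rcons sz.
- move=> x; rewrite mem_rcons inE => /predU1P[->//|/sb].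
  exact/(fsubsetP (wball_le (leqnSn _))).
- move=> i j; rewrite !nth_rcons sz !ltnS => iN jN.
  case: (ltngtP i n.+1) iN => // iN _; case: (ltngtP j n.+1) jN => // jN _.
  + by rewrite !ltnS in iN jN; rewrite iN jN; exact: sH.
  + by rewrite ltnS in iN; rewrite iN jN ltnn => /Hy; case.
  + by rewrite ltnS in jN; rewrite jN iN ltnn => /HV; rewrite invgM invgK => /Hy; case.
  + by rewrite iN jN.
Qed.

Lemma infinite_not_virtually_cyclic : ~ virtually_cyclic G -> infinite_set [set: G].
Proof.
move=> nvc fin; apply: nvc; exists 1%g; apply: finite_image.
exact: sub_finite_set fin.
Qed.

(* An element [g] of infinite order and [n.+1] cosets of [<g>] met by the ball
   of radius [n] yield [n.+1 ^ 2] elements in a wball of radius linear in [n]. *)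
Lemma superlinear_growth c : ~ virtually_cyclic G ->
  exists r, c * r.*2.+1 < #|` wball T r|.
Proof.
move=> nvc; have inf := infinite_not_virtually_cyclic nvc.
apply: contrapT => /forallNP H; have {H} lin r : #|` wball T r| <= c * r.*2.+1.
  by rewrite leqNgt; exact/negP.
have [g gk] := infinite_order_of_linear_growth inf lin.
have [q gq] := wball_exhaust g.
(* With this [n] the linear bound at radius [n + n * q] equals [n * n + c], which is less than
   [n.+1 * n.+1] because [c <= n]. *)
have [n nE] : exists n, n = (c * q.+1).*2 by exists (c * q.+1).*2.
have [s [sz sb sH]] := many_cosets g n nvc.
have [H1 HM HV] := gen1_subgroup g.
pose f (p : 'I_n.+1 * 'I_n.+1) := (nth 1 s p.1 * g ^+ p.2)%g.
have inj : injective f.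
  move=> [i k] [j l]; rewrite /f /= => e.
  have ij : i = j.
    apply/val_inj/sH; [exact: leq_ord|exact: leq_ord|].
    have -> : ((nth 1 s i)^-1 * nth 1 s j = g ^+ k * (g ^+ l)^-1)%g.
      by apply: (mulgI (nth 1 s i)%g); rewrite mulgA mulgV mul1g mulgA e mulgK.
    by apply: HM; [|apply: HV]; exact: gen1X.
  subst j; move/mulgI: e => e; congr pair; apply/val_inj.
  have aux (a b : nat) : (g ^+ a = g ^+ b)%g -> a <= b -> a = b.
    move=> eab ab; case: (posnP (b - a)) => [|p]; first lia.
    have /eqP[] := gk _ p; apply: (mulgI (g ^+ a)%g).
    by rewrite -expgnDr subnKC // mulg1.
  by case/orP: (leq_total k l) => [/(aux _ _ e)|/(aux _ _ (esym e))].
have : n.+1 * n.+1 <= #|` wball T (n + n * q)|.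
  have <- : size [seq f p | p <- enum {: 'I_n.+1 * 'I_n.+1}] = n.+1 * n.+1.
    by rewrite size_map -cardE card_prod !card_ord.
  apply: uniq_leq_size; first by rewrite map_inj_uniq // enum_uniq.
  move=> _ /mapP[[i k] _ ->]; apply: wballD; first by rewrite sb // mem_nth // sz.
  by apply: (fsubsetP (wball_le _)); [|exact: wballX gq]; rewrite leq_mul2r -ltnS ltn_ord orbT.
move=> /leq_trans /(_ (lin _)).
have -> : c * (n + n * q).*2.+1 = n * (c * q.+1).*2 + c by lia.
rewrite -nE.
have cn : c <= n by rewrite nE -muln2 -mulnA leq_pmulr.
by rewrite mulnS; lia.
Qed.

End Symmetric.
End WordBalls.

(** * Sparse trees through the boundary of a Folner set *)

Section SparseConnected.
Variables (G : groupType) (K : {fset G}).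
Hypothesis K1 : 1%g \in K.
Hypothesis KV : forall t, t \in K -> (t^-1)%g \in K.
Hypothesis Kgen : generates K.
Implicit Types (A D E : {fset G}) (l N : seq G).

(* [l] lists, latest first, the vertices of a subtree of the Cayley graph
   grown from the identity. *)
Fixpoint grown l : Prop :=
  if l is x :: l' then
    grown l' /\ (x = 1%g \/ exists t y, [/\ t \in K, y \in l' & x = (t * y)%g])
  else True.

Lemma grow_path m b l x : grown l -> x \in l -> b \in wball K m ->
  exists2 l', grown (l' ++ l) & (b * x)%g \in l' ++ l /\ (size l' <= m)%N.
Proof.
move=> gl xl; elim: m b => [|m IH] b.
  by rewrite in_wball0 => /eqP ->; exists [::]; rewrite // mul1g.
move=> /wballSP[t tK [y /IH[l' gl' [yl' sl']] ->]].
exists ((t * y * x)%g :: l'); rewrite /= ?inE ?eqxx //; split => //.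
by right; exists t, (y * x)%g; rewrite mulgA.
Qed.

Lemma grow_paths m l N (s : seq G) : grown l -> {subset N <= l} ->
  (forall x, x \in s -> exists2 y, y \in N & (x * y^-1)%g \in wball K m) ->
  exists l', [/\ grown l', {subset l <= l'}, {subset s <= l'} &
    (size l' <= size l + size s * m)%N].
Proof.
move=> gl Nl; elim: s => [|x s IH] H; first by exists l; split => //; rewrite addn0.
have [|l' [gl' ll' sl' zl']] := IH.
  by move=> y ys; apply: H; rewrite inE ys orbT.
have [|y yN xb] := H x; first by rewrite inE eqxx.
have [l'' gl'' [xl'' sl'']] := grow_path gl' (ll' _ (Nl _ yN)) xb.
rewrite mulgVK in xl''.
exists (l'' ++ l'); split => //.
- by move=> z /ll'; rewrite mem_cat => ->; rewrite orbT.
- by move=> z; rewrite inE mem_cat => /predU1P[->|/sl' ->]; rewrite ?orbT // -mem_cat.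
- rewrite size_cat /=; lia.
Qed.

(** The inner boundary. It lies inside the set, so the inner boundaries of disjoint pieces are
    disjoint and their sizes can be added. *)
Definition ibd T A : {fset G} := (A `&` bdry T A)%fset.

Lemma in_ibd T A x : (x \in ibd T A) = (x \in A) && ~~ all (fun t => (t * x \in A)%g) T.
Proof.
rewrite in_fsetI in_bdry. case: (x \in A) => //=.
rewrite -has_predC. by apply: eq_has => t /=; case: (_ \in A).
Qed.

Lemma ibd_rtrans T A c : ibd T (rtrans A c) = rtrans (ibd T A) c.
Proof. by apply/fsetP => x; rewrite /ibd bdry_rtrans !(in_rtrans, in_fsetI). Qed.

Definition connected_in A := forall B, (B `<=` A)%fset -> B != fset0 -> B != A ->
  exists2 x, x \in B & exists2 t, t \in K & (t * x)%g \in (A `\` B)%fset.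

(** A path that starts in [A] and stays in [D] never leaves [A]; hence a point of [A] whose [r]-ball
    lies in [D] has its [r]-ball in [A]. *)
Lemma ibd_component r A D : (A `<=` D)%fset ->
  (forall x t, x \in A -> t \in K -> (t * x)%g \in D -> (t * x)%g \in A) ->
  (ibd (wball K r) A `<=` ibd (wball K r) D)%fset.
Proof.
move=> AD cl; apply/fsubsetP => x; rewrite !in_ibd => /andP[xA].
rewrite (fsubsetP AD _ xA) /=; apply: contra => /allP bD; apply/allP.
elim: r bD => [|r IH] bD b.
  by rewrite in_wball0 => /eqP ->; rewrite mul1g.
move=> /wballSP[t tK [y yb ->]]; rewrite -mulgA; apply: cl => //.
  by apply: IH => // b' b'b; apply/bD/(fsubsetP (wball_le K1 (leqnSn _))).
by rewrite mulgA; apply: bD; apply/wballSP; exists t => //; exists y.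
Qed.

(* A nonempty set of minimal cardinality among those of small boundary is
   connected: the boundary of a disconnected set splits with the set. *)
Lemma connected_folner (R : realType) (d : R) r :
  (exists2 D : {fset G}, D != fset0 & almost_inv (wball K r) d D) ->
  exists D, [/\ 1%g \in D, connected_in D &
    (#|` ibd (wball K r) D|%:R <= d * #|` D|%:R)%R].
Proof.
move=> [D0 D00 invD0].
pose P n := `[< exists D, [/\ D != fset0, #|` D| = n &
  (#|` ibd (wball K r) D|%:R <= d * #|` D|%:R)%R] >].
have exP : exists n, P n.
  exists #|` D0|; apply/asboolP; exists D0; split => //.
  by apply: le_trans invD0; rewrite ler_nat fsubset_leq_card // fsubsetIr.
case: (ex_minnP exP) => n /asboolP[D1 [/fset0Pn[x xD1] cD1 bD1]] minn.
exists (rtrans D1 x^-1); rewrite ibd_rtrans !card_rtrans in_rtrans invgK mul1g.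
split => // B BD B0 BnD; apply: contrapT => /forall2NP nedge.
set D := rtrans D1 x^-1 in BD BnD nedge.
have bD : (#|` ibd (wball K r) D|%:R <= d * #|` D|%:R)%R.
  by rewrite ibd_rtrans !card_rtrans.
have cD : #|` D| = n by rewrite card_rtrans.
have stay y t : y \in B -> t \in K -> (t * y)%g \in D -> (t * y)%g \in B.
  move=> yB tK tyD; apply: contrapT => /negP tyB.
  case: (nedge y) => // H; apply: H; exists t => //.
  by rewrite in_fsetD tyD tyB.
have stay' y t : y \in (D `\` B)%fset -> t \in K -> (t * y)%g \in D ->
    (t * y)%g \in (D `\` B)%fset.
  rewrite !in_fsetD => /andP[yB yD] tK tyD; rewrite tyD andbT.
  by apply: contra yB => tyB; rewrite -(mulKg t y); apply: stay; rewrite ?KV ?mulKg.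
have c1 := fsubset_leq_card (ibd_component r BD stay).
have := cardfsID (ibd (wball K r) B) (ibd (wball K r) D).
have DB0 : (D `\` B)%fset != fset0.
  by rewrite fsetD_eq0; apply: contra BnD => DB; rewrite eqEfsubset BD.
have := cardfsDS BD; have := fsubset_leq_card BD.
have : (0 < #|` B|)%N by rewrite cardfs_gt0.
have : (0 < #|` (D `\` B)%fset|)%N by rewrite cardfs_gt0.
move=> p1 p2 cBD cDB cI.
have cc : (#|` ibd (wball K r) B| + #|` ibd (wball K r) (D `\` B)%fset| <=
    #|` ibd (wball K r) D|)%N.
  rewrite -cI (fsetIidPr (ibd_component r BD stay)) leq_add2l fsubset_leq_card //.
  apply/fsubsetP => y yI.
  rewrite in_fsetD (fsubsetP (ibd_component r (fsubsetDl _ _) stay')) // andbT.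
  by move: yI; rewrite !in_ibd in_fsetD => /andP[/andP[/negbTE -> _] _].
(* Sizes and inner boundaries both add up over the two pieces, so one piece inherits the ratio [d],
   against the minimality of [n]. *)
have /orP[H|H] : (#|` ibd (wball K r) B|%:R <= d * #|` B|%:R)%R ||
    (#|` ibd (wball K r) (D `\` B)%fset|%:R <= d * #|` (D `\` B)%fset|%:R)%R.
- apply: contraT; rewrite negb_or -!ltNge => /andP[h1 h2].
  move: cc; rewrite -(ler_nat R) natrD => cc.
  have : (#|` D|%:R = #|` B|%:R + #|` (D `\` B)%fset|%:R :> R)%R.
    by rewrite -natrD cDB subnKC.
  by move: bD => /[swap] ->; rewrite (mulrDr d); lra.
- have /minn : P #|` B| by apply/asboolP; exists B.
  by rewrite leqNgt -cD -subn_gt0 -cDB p1.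
- have /minn : P #|` (D `\` B)%fset| by apply/asboolP; exists (D `\` B)%fset.
  by rewrite leqNgt -cD cDB ltn_subrL p2 (leq_trans p2).
Qed.

Definition separated r N := uniq N /\
  {in N &, forall x y, (x * y^-1)%g \in wball K r -> x = y}.

(** Net and tree grow together. While some point of [E] is farther than [r] from the net,
    connectedness gives an edge from a covered to an uncovered point; the latter is within [r.+1] of
    the net, so adding it costs at most [r.+1] vertices. A net inside [E] cannot outgrow [|E|]. *)
Lemma separated_net r E : 1%g \in E -> connected_in E -> exists N l,
  [/\ separated r N, grown l, {subset N <= E} /\ {subset N <= l},
     (size l <= size N * r.+1)%N &
     forall x, x \in E -> exists2 y, y \in N & (x * y^-1)%g \in wball K r].
Proof.
move=> E1 conn; apply: contrapT => nex.
suff H k : exists N l, [/\ size N = k.+1, separated r N, grown l,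
    [/\ {subset N <= E}, {subset N <= l} & 1%g \in N] & (size l <= size N * r.+1)%N].
  have [N [l [sN [uN _] _ [NE _ _] _]]] := H #|` E|.
  by have := uniq_leq_size uN NE; rewrite sN ltnn.
elim: k => [|k [N [l [sN [uN sepN] gl [NE Nl N1] sl]]]].
  exists [:: 1%g], [:: 1%g]; split => //=.
  - by split => // x y; rewrite !inE => /eqP -> /eqP ->.
  - by split=> //; left.
  - by split; [move=> x|move=> x|]; rewrite !inE //; move/eqP ->.
pose C := [fset x in E | has (fun y => (x * y^-1)%g \in wball K r) N]%fset.
have inC x : (x \in C) = (x \in E) && has (fun y => (x * y^-1)%g \in wball K r) N.
  by rewrite !inE.
have C1 : 1%g \in C.
  by rewrite inC E1 /=; apply/hasP; exists 1%g; rewrite // mulgV wball_id.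
have [|||x xC [t tK]] := conn C.
- by apply/fsubsetP => x; rewrite inC => /andP[].
- by apply/fset0Pn; exists 1%g.
- apply/eqP => CE; apply: nex; exists N, l; split => // x.
  by rewrite -{1}CE inC => /andP[_ /hasP[y yN H]]; exists y.
rewrite in_fsetD inC => /andP[+ txE]; rewrite txE /= => /hasPn ntx.
move: xC; rewrite inC => /andP[xE /hasP[y yN xy]].
have txb : (t * x * y^-1)%g \in wball K r.+1.
  by apply/wballSP; exists t => //; exists (x * y^-1)%g; rewrite ?mulgA.
have [l' gl' [xl' sl']] := grow_path gl (Nl _ yN) txb.
rewrite mulgVK in xl'.
exists ((t * x)%g :: N), (l' ++ l); split => //=.
- by rewrite sN.
- have txN : (t * x)%g \notin N.
    by apply/negP => /ntx; rewrite mulgV wball_id.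
  split=> /=; first by rewrite txN.
  move=> a b; rewrite !inE => /predU1P[->|aN] /predU1P[->|bN] //.
  + by move=> /[dup] H; have /negP := ntx _ bN; rewrite H.
  + by move=> /(wballV KV); rewrite invgM invgK => H; have := ntx _ aN; rewrite H.
  + exact: sepN.
- split.
  + by move=> a; rewrite inE => /predU1P[->//|/NE].
  + by move=> a; rewrite inE => /predU1P[->//|/Nl]; rewrite mem_cat => ->; rewrite orbT.
  + by rewrite inE N1 orbT.
- by rewrite size_cat mulSn leq_add.
Qed.

(** The [r]-balls around the points of a [2 r]-separated set are disjoint, and they lie in [E]
    except around points of the inner boundary. *)
Lemma separated_card r E N : separated r.*2 N -> {subset N <= E} ->
  (size N * #|` wball K r| <= #|` E| + #|` ibd (wball K r) E| * #|` wball K r|)%N.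
Proof.
move=> [uN sepN] NE; pose N' := [seq x <- N | x \notin ibd (wball K r) E].
have sN : (size N <= size N' + #|` ibd (wball K r) E|)%N.
  rewrite size_filter -(count_predC (fun x => x \notin ibd (wball K r) E) N) leq_add2l.
  rewrite -size_filter uniq_leq_size ?filter_uniq // => x.
  by rewrite mem_filter /= negbK => /andP[].
suff : (size N' * #|` wball K r| <= #|` E|)%N.
  move=> H; apply: leq_trans (leq_mul sN (leqnn _)) _.
  by rewrite mulnDl leq_add2r.
pose s := [seq (b * x)%g | x <- N', b <- enum_fset (wball K r)].
have <- : size s = (size N' * #|` wball K r|)%N by rewrite size_allpairs.
apply: uniq_leq_size.
  apply: allpairs_uniq; rewrite ?filter_uniq ?fset_uniq //.
  move=> _ _ /allpairsP[[x b] /= [xN bb ->]] /allpairsP[[y c] /= [yN cc ->]] /= e.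
  have exy : x = y.
    move: xN yN; rewrite !mem_filter => /andP[_ xN] /andP[_ yN].
    apply: sepN => //; have -> : (x * y^-1 = b^-1 * c)%g.
      by apply: (mulgI b); rewrite mulgA e mulVKg mulgK.
    by rewrite -addnn wballD // wballV.
  by rewrite exy in e *; move/mulIg: e => ->.
move=> _ /allpairsP[[x b] /= [+ bb ->]]; rewrite mem_filter in_ibd.
by move=> /andP[+ /NE xE]; rewrite xE /= negbK => /allP/(_ _ bb).
Qed.

(** Arithmetic for [sparse_boundary_tree]: [L] is the length of a joining path, [b] the size of a
    ball, [n] that of the net, [beta] and [bd] those of the inner and the full boundary. The main
    term [E * L / b] and the boundary terms each cost at most [d / 2 * E]. *)
Lemma tree_size_bound (R : realType) (d e L b beta k n E l l' bd c : R) :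
  (0 <= L -> 0 <= k -> 0 <= n -> 0 <= E -> 0 <= beta -> 0 <= bd -> 0 < d ->
   e * L * (k + 1) = d / 2 -> 0 < b -> c * L <= b -> 2 < d * c ->
   n * b <= E + beta * b -> beta <= e * E -> l <= n * L -> l' <= l + bd * L ->
   bd <= k * beta -> l' <= d * E)%R.
Proof.
move=> L0 k0 n0 E0 be0 bd0 d0 eE b0 cL dc nb beE lL lbd bdk.
have H1 : (2 * L <= d * b)%R.
  have := ler_wpM2l (ltW d0) cL; have := ler_wpM2r L0 (ltW dc); lra.
have H2 : (n * L <= E * d / 2 + beta * L)%R.
  rewrite -(ler_pM2r b0); have := ler_wpM2r L0 nb; have := ler_wpM2r E0 H1; lra.
have H3 := ler_wpM2r L0 bdk.
have kL : (0 <= L * (k + 1))%R by rewrite mulr_ge0 // addr_ge0.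
have H4 := ler_wpM2r kL beE.
have H5 : (e * E * (L * (k + 1)) = d / 2 * E)%R by rewrite -eE; ring.
lra.
Qed.

Lemma sparse_boundary_tree (R : realType) (d : R) : ~ virtually_cyclic G -> (0 < d)%R ->
  (forall T (e : R), (0 < e)%R -> exists2 D : {fset G}, D != fset0 & almost_inv T e D) ->
  exists E l, [/\ E != fset0, grown l, {subset bdry K E <= l} &
    ((size l)%:R <= d * #|` E|%:R)%R].
Proof.
move=> nvc d0 fol; pose c := (Num.truncn (2 * d^-1)).+1.
have dc : (2 < d * c%:R)%R.
  rewrite -(ltr_pM2l (x := d^-1%R)) ?invr_gt0 // mulrA mulVf ?gt_eqF // mul1r mulrC.
  by rewrite /c truncnS_gt.
have [r rb] := superlinear_growth K1 Kgen c nvc.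
have r0 : (0 < r)%N.
  case: r rb => //; rewrite /= /c cardfs1; lia.
(* Inner boundary points enter with weight [#|] K|.+1[: once through]separated_card[, and]#|[K|]
   times through the boundary points to be joined. *)
pose e : R := (d / (2 * (r.*2.+1)%:R * (#|` K|.+1)%:R))%R.
have e0 : (0 < e)%R by rewrite divr_gt0 // !mulr_gt0 // ltr0n.
have [E [E1 connE bE]] := connected_folner (fol (wball K r) e e0).
have [N [l [sepN gl [NE Nl] sl cov]]] := separated_net r.*2 E1 connE.
have cN := separated_card sepN NE.
have sKb : (#|` bdry K E| <= #|` K| * #|` ibd (wball K r) E|)%N.
  apply: (@leq_trans #|` [fset (t * x)%g | t in K, x in ibd (wball K r) E]%fset|).
    apply: fsubset_leq_card; apply/fsubsetP => x /bdryP[t tK txE].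
    have tb : t \in wball K r by exact/(fsubsetP (wball_le K1 r0))/wball1.
    have tVb : (t^-1)%g \in wball K r by exact/(fsubsetP (wball_le K1 r0))/wball1/KV.
    apply/imfset2P; case: (boolP (x \in E)) txE => xE txE.
      exists 1%g => //; exists x; rewrite ?mul1g //= in_ibd xE.
      by apply/allPn; exists t => //; move: txE; case: (_ \in E).
    exists (t^-1)%g; first exact: KV.
    exists (t * x)%g; rewrite ?mulKg //= in_ibd.
    have -> : (t * x)%g \in E by move: txE; case: (_ \in E).
    by apply/allPn; exists (t^-1)%g; rewrite // mulKg.
  rewrite -(size_allpairs (fun t x => (t * x)%g)).
  apply: uniq_leq_size => [|x /imfset2P[t tK [y yI ->]]]; first exact: fset_uniq.
  exact: allpairs_f.
(* A boundary point may lie outside [E], one step away from it, so it is within [r.*2.+1] of a net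
   that is [r.*2]-dense in [E]. *)
have [|l' [gl' ll' bl' sl']] := grow_paths (m := r.*2.+1) (s := enum_fset (bdry K E)) gl Nl.
  move=> x xb.
  have [t tK txE] : exists2 t, t \in K & (t * x)%g \in E.
    case: (boolP (x \in E)) => xE; first by exists 1%g; rewrite ?mul1g.
    have /bdryP[t tK] := xb; rewrite (negbTE xE) => H; exists t => //.
    by move: H; case: (_ \in E).
  have [y yN xy] := cov _ txE; exists y => //.
  apply/wballSP; exists (t^-1)%g; first exact: KV.
  by exists (t * x * y^-1)%g => //; rewrite -!mulgA mulKg.
exists E, l'; split => //; first by apply/fset0Pn; exists 1%g.
apply: (@tree_size_bound R d e (r.*2.+1)%:R #|` wball K r|%:R #|` ibd (wball K r) E|%:R
  #|` K|%:R (size N)%:R #|` E|%:R (size l)%:R (size l')%:R #|` bdry K E|%:R c%:R) => //.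
- have : (r.*2.+1)%:R%R != 0%R :> R by rewrite pnatr_eq0.
  have : (#|` K|.+1)%:R%R != 0%R :> R by rewrite pnatr_eq0.
  rewrite natr1 /e; move: (_.+1%:R)%R (_.+1%:R)%R => k1 L k0 L0.
  by field; rewrite L0 k0.
- by rewrite ltr0n cardfs_gt0; apply/fset0Pn; exists 1%g; exact: wball_id.
- by rewrite -natrM ler_nat ltnW.
- by rewrite -!natrM -natrD ler_nat.
- by rewrite -natrM ler_nat.
- by rewrite -natrM -natrD ler_nat.
- by rewrite -natrM ler_nat.
Qed.

End SparseConnected.

(** * Entropy through colorings *)

Section Colorings.
Variable X : Type.
Implicit Types P Q : X -> X -> Prop.

Definition colorable n P := exists c : X -> 'I_n, forall x y, c x = c y -> P x y.

Lemma colorableS n P Q : (forall x y, P x y -> Q x y) -> colorable n P -> colorable n Q.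
Proof. by move=> PQ [c Hc]; exists c => x y /Hc /PQ. Qed.

Lemma colorable_le n m P : (n <= m)%N -> colorable n P -> colorable m P.
Proof.
move=> nm [c Hc]; exists (fun x => widen_ord nm (c x)) => x y [e].
by apply: Hc; exact: val_inj.
Qed.

Lemma colorable_prod n m P Q : colorable n P -> colorable m Q ->
  colorable (n * m) (fun x y => P x y /\ Q x y).
Proof.
move=> [c Hc] [d Hd]; rewrite -[n]card_ord -[m in (_ * m)%N]card_ord -card_prod.
exists (fun x => enum_rank (c x, d x)) => x y /enum_rank_inj [e1 e2].
by split; [exact: Hc|exact: Hd].
Qed.

Lemma colorable_comp Y (f : Y -> X) n P : colorable n P ->
  exists c : Y -> 'I_n, forall x y, c x = c y -> P (f x) (f y).
Proof. by move=> [c Hc]; exists (c \o f) => x y /Hc. Qed.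

(** The second coloring may depend on the first color: each class of the first coloring has a
    representative [x0] and uses the coloring attached to it. *)
Lemma colorable_dep n m P Q : colorable n P ->
  (forall x0, colorable m (fun y z => P x0 y -> P x0 z -> Q y z)) -> colorable (n * m) Q.
Proof.
move=> [c Hc] HQ; have [[x1 _]|nX] := pselect (exists x : X, True); last first.
  by exists (fun x => False_rect _ (nX (ex_intro _ x I))) => x; case: nX; exists x.
have : forall i : 'I_n, exists d : X -> 'I_m, forall y z,
    c y = i -> c z = i -> d y = d z -> Q y z.
  move=> i; have [[x0 cx0]|nx] := pselect (exists x, c x = i).
    have [d Hd] := HQ x0; exists d => y z cy cz /Hd; apply; apply: Hc; congruence.
  by have [d _] := HQ x1; exists d => y z cy; case: nx; exists y.
move=> /choice[d Hd].
rewrite -[n]card_ord -[m in (_ * m)%N]card_ord -card_prod.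
exists (fun x => enum_rank (c x, d (c x) x)) => x y /enum_rank_inj [e1 e2].
by apply: (Hd (c y)) => //; rewrite -[in d _ x]e1.
Qed.

(** The value is 0 when no finite coloring exists. *)
Definition mincol P : nat :=
  if pselect (exists n, `[< colorable n P >]) is left exP then ex_minn exP else 0.

Lemma mincolP n P : colorable n P -> colorable (mincol P) P.
Proof.
move=> cP; rewrite /mincol; case: pselect => [exP|[]]; last by exists n; apply/asboolP.
by case: ex_minnP => k /asboolP.
Qed.

Lemma mincol_le n P : colorable n P -> (mincol P <= n)%N.
Proof.
move=> cP; rewrite /mincol; case: pselect => // exP.
by case: ex_minnP => k _; apply; apply/asboolP.
Qed.

Lemma colorable_gt0 n P (x : X) : colorable n P -> (0 < n)%N.
Proof. by move=> [c _]; case: (c x) => k; exact: leq_ltn_trans. Qed.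

Lemma colorable_uniq_size (T : eqType) (f : T -> X) n P (s : seq T) : colorable n P ->
  uniq s -> {in s &, forall x y, x != y -> ~ P (f x) (f y)} -> (size s <= n)%N.
Proof.
move=> [c Hc] us H.
have : uniq [seq c (f x) | x <- s].
  rewrite map_inj_in_uniq // => x y xs ys /Hc Pxy; apply/eqP.
  by apply: contraT => nxy; case: (H x y xs ys nxy).
by move=> /card_uniqP; rewrite size_map => <-; rewrite -[leqRHS]card_ord max_card.
Qed.

End Colorings.

(** * Relations that hold locally on a compact metric space *)

Section LocalRelations.
Variables (R : realType) (X : metricType R).
Implicit Types P Q : X -> X -> Prop.
Local Open Scope ring_scope.

Definition local_rel P := forall x : X, exists2 U, nbhs x U & forall y z, U y -> U z -> P y z.

Lemma local_relI P Q : local_rel P -> local_rel Q -> local_rel (fun x y => P x y /\ Q x y).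
Proof.
move=> HP HQ x; have [U Ux HU] := HP x; have [V Vx HV] := HQ x.
exists (U `&` V); first exact: filterI.
by move=> y z [Uy Vy] [Uz Vz]; split; [exact: HU|exact: HV].
Qed.

Lemma local_rel_all (T : eqType) (s : seq T) (P : T -> X -> X -> Prop) :
  (forall t, t \in s -> local_rel (P t)) ->
  local_rel (fun x y => forall t, t \in s -> P t x y).
Proof.
elim: s => [|a s IH] H; first by move=> x; exists setT => //; exact: filterT.
have HI : local_rel (fun x y => P a x y /\ forall t, t \in s -> P t x y).
  apply: local_relI; first by apply: H; rewrite inE eqxx.
  by apply: IH => t ts; apply: H; rewrite inE ts orbT.
move=> x; have [U Ux HU] := HI x.
exists U => // y z Uy Uz t; rewrite inE => /predU1P[->|ts].
  by case: (HU y z Uy Uz).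
by case: (HU y z Uy Uz) => _; apply.
Qed.

Lemma ball_cover P : compact [set: X] -> local_rel P ->
  exists (s : seq X) (r : X -> R), (forall x, 0 < r x) /\
    (forall y, exists2 x, x \in s & mdist x y < r x) /\
    forall x y z, mdist x y < 2 * r x -> mdist x z < 2 * r x -> P y z.
Proof.
move=> cX HP.
have : forall x, exists r : R, 0 < r /\
    forall y z, mdist x y < 2 * r -> mdist x z < 2 * r -> P y z.
  move=> x; have [U Ux HU] := HP x.
  move: Ux; rewrite -nbhs_ballE => -[e /= e0 eU]; exists (e / 2).
  rewrite divr_gt0 //; split => // y z; rewrite mulrC divfK // => xy xz.
  by apply: HU; apply: eU; rewrite ballEmdist.
move=> /choice[r Hr].
(* The near-covering form of compactness, applied to finite sequences directed by inclusion, yields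
   a finite subcover. *)
pose F : set_system (seq X) :=
  [set B : set (seq X) | exists s0 : seq X, forall s : seq X, {subset s0 <= s} -> B s].
have FF : Filter F.
  constructor; first by exists [::].
  - move=> A B [s Hs] [t Ht]; exists (s ++ t) => u su; split.
      by apply: Hs => x xs; apply: su; rewrite mem_cat xs.
    by apply: Ht => x xs; apply: su; rewrite mem_cat xs orbT.
  - by move=> A B AB [s Hs]; exists s => t /Hs /AB.
move/compact_near_coveringP: cX.
move=> /(_ (seq X) F (fun s y => exists2 x : X, x \in s & mdist x y < r x) FF) [].
  move=> x _; exists (ball x (r x), [set s : seq X | x \in s]) => /=.
    split; first by apply: nbhsx_ballx; case: (Hr x).
    by exists [:: x] => s; apply; rewrite inE.
  by move=> [y s] /= []; rewrite ballEmdist /= => xy xs; exists x.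
move=> s0 /(_ s0 (fun _ h => h)) cov; exists s0, r; split; first by move=> x; case: (Hr x).
by split => [y|x]; [exact: cov|case: (Hr x)].
Qed.

Lemma local_rel_colorable P : compact [set: X] -> local_rel P -> exists n, colorable n P.
Proof.
move=> cX /(ball_cover cX) [s [r [r0 [cov HP]]]].
pose f y := find (fun x => mdist x y < r x) s.
have fs y : (f y < size s)%N.
  by rewrite /f -has_find; have [x xs xy] := cov y; apply/hasP; exists x.
exists (size s), (fun y => Ordinal (fs y)) => y z [e].
have aux w : mdist (nth y s (f w)) w < 2 * r (nth y s (f w)).
  have : mdist (nth y s (f w)) w < r (nth y s (f w)).
    by apply: (@nth_find _ y (fun x => mdist x w < r x)); rewrite has_find; exact: fs.
  by have := r0 (nth y s (f w)); lra.
by apply: (HP (nth y s (f y))); [exact: aux|rewrite e; exact: aux].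
Qed.

Lemma lebesgue_number P : compact [set: X] -> local_rel P ->
  exists2 d, 0 < d & forall x y, mdist x y <= d -> P x y.
Proof.
move=> cX /(ball_cover cX) [s [r [r0 [cov HP]]]].
have [d d0 Hd] : exists2 d, 0 < d & forall x, x \in s -> d <= r x.
  elim: s {cov HP} => [|x s [d d0 IH]]; first by exists 1.
  exists (Num.min d (r x)); first by rewrite lt_min d0 r0.
  move=> y; rewrite inE => /predU1P[->|/IH]; rewrite ge_min ?lexx ?orbT //.
  by move->.
exists d => // y z yz; have [x xs xy] := cov y.
have := Hd _ xs; have := metric_triangle x y z; have := r0 x => rx t dr.
by apply: (HP x); lra.
Qed.

End LocalRelations.

(** * Coloring numbers of Bowen closeness and separated sets *)

Section BowenEntropy.
Variables (R : realType) (G : groupType) (X : metricType R) (alpha : G -> X -> X).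
Hypothesis cX : compact [set: X].
Hypothesis act : action_by_homeo alpha.
Implicit Types (A B F : {fset G}) (eps : R).
Local Open Scope ring_scope.

Definition close F eps (x y : X) :=
  forall s, s \in F -> mdist (alpha s x) (alpha s y) <= eps.

Lemma close_local F eps : 0 < eps -> local_rel (close F eps).
Proof.
move=> e0; apply: (@local_rel_all _ _ _ (enum_fset F)
  (fun s x y => mdist (alpha s x) (alpha s y) <= eps)) => s _ x.
have [_ _ /(_ s x) cs] := act.
exists (alpha s @^-1` ball (alpha s x) (eps / 2)).
  by apply: cs; apply: nbhsx_ballx; rewrite divr_gt0.
move=> y z; rewrite /= !ballEmdist /= => h1 h2.
have := metric_triangle (alpha s y) (alpha s x) (alpha s z).
by rewrite (metric_sym (alpha s y) (alpha s x)); lra.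
Qed.

Definition col F eps := mincol (close F eps).

Lemma colP F eps : 0 < eps -> colorable (col F eps) (close F eps).
Proof.
by move=> /(close_local F) /(local_rel_colorable cX) [n]; exact: mincolP.
Qed.

Definition logcol eps F : R := ln (col F eps)%:R.

Lemma le_logcol eps F n : (0 < n)%N -> colorable n (close F eps) -> logcol eps F <= ln n%:R.
Proof.
move=> n0 cn; rewrite /logcol; have [->|c0] := posnP (col F eps).
  by rewrite ln0 // ln_ge0 // ler1n.
by rewrite ler_ln ?posrE ?ltr0n // ler_nat; exact: mincol_le cn.
Qed.

Variable x0 : X.

Lemma col_gt0 F eps : 0 < eps -> (0 < col F eps)%N.
Proof. by move=> /(colP F); exact: colorable_gt0. Qed.

Lemma logcol0 eps : logcol eps fset0 = 0.
Proof.
have c1 : colorable 1 (close fset0 eps).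
  by exists (fun=> ord0) => x y _ s; rewrite in_fset0.
rewrite /logcol /col; have := mincol_le c1; have := colorable_gt0 x0 (mincolP c1).
by case: (mincol _) => [|[]] // _ _; rewrite ln1.
Qed.

Lemma logcolU eps A B : 0 < eps -> logcol eps (A `|` B)%fset <= logcol eps A + logcol eps B.
Proof.
move=> e0; rewrite /logcol -lnM ?posrE ?ltr0n ?col_gt0 // -natrM.
apply: le_logcol; first by rewrite muln_gt0 !col_gt0.
apply: colorableS (colorable_prod (colP A e0) (colP B e0)) => x y [HA HB] s.
by rewrite in_fsetU => /orP[/HA|/HB].
Qed.

Lemma logcolS eps A B : 0 < eps -> (A `<=` B)%fset -> logcol eps A <= logcol eps B.
Proof.
move=> e0 AB; apply: le_logcol; first exact: col_gt0.
by apply: colorableS (colP B e0) => x y H s sA; apply: H; exact: (fsubsetP AB).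
Qed.

Lemma logcol_rtrans eps A c : 0 < eps -> logcol eps (rtrans A c) = logcol eps A.
Proof.
move=> e0; have [a1 aM _] := act.
have le B b : logcol eps (rtrans B b) <= logcol eps B.
  apply: le_logcol; first exact: col_gt0.
  have [d Hd] := colorable_comp (alpha b) (colP B e0); exists d => x y /Hd H s.
  rewrite in_rtrans => /H; by rewrite -!aM mulgVK.
apply/eqP; rewrite eq_le le /=.
have {1}-> : A = rtrans (rtrans A c) c^-1%g.
  by apply/fsetP => x; rewrite !in_rtrans invgK mulgK.
exact: le.
Qed.

Lemma logcol_ornstein_weiss eps (c eta : R) : 0 < eps -> 0 <= c -> 0 < eta ->
  (forall K (d : R), 0 < d -> exists D, [/\ D != fset0, almost_inv K d D &
     logcol eps D <= c * #|` D|%:R]) ->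
  exists K (d : R), 0 < d /\ forall A, almost_inv K d A -> logcol eps A <= (c + eta) * #|` A|%:R.
Proof.
move=> e0; apply: ornstein_weiss; first exact: logcol0.
- by move=> A B; exact: logcolU.
- by move=> A B; exact: logcolS.
- by move=> A c'; exact: logcol_rtrans.
Qed.

Lemma separated_card_le F eps (S : {fset X}) n :
  eps_separated alpha F eps S -> colorable n (close F eps) -> (#|` S| <= n)%N.
Proof.
move=> sS cn; apply: (colorable_uniq_size (f := id) cn) => [|x y xS yS nxy H].
  exact: fset_uniq.
have [s sF] := sS x y xS yS nxy.
by rewrite ltNge (H s sF).
Qed.

Lemma sep_le_col F eps : 0 < eps -> (sep alpha F eps <= (col F eps)%:R%:E)%E.
Proof.
move=> e0; apply: ge_ereal_sup => _ [S sS <-].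
by rewrite lee_fin ler_nat; exact: separated_card_le sS (colP F e0).
Qed.

Lemma sep_ge1 F eps : (1 <= sep alpha F eps)%E.
Proof.
apply: ereal_sup_ubound; exists [fset x0]%fset; last by rewrite cardfs1.
by move=> x y; rewrite !inE => /eqP -> /eqP ->; rewrite eqxx.
Qed.

(** A separated set of maximal size is spanning: color each point by an [eps]-close member of it, so
    points of one color are [2 * eps]-close. *)
Lemma col_le_sep F eps : 0 < eps -> ((col F (2 * eps))%:R%:E <= sep alpha F eps)%E.
Proof.
move=> e0.
pose P n := `[< exists2 S, eps_separated alpha F eps S & #|` S| = n >].
have exP : exists n, P n.
  by exists 0%N; apply/asboolP; exists fset0 => // x y; rewrite inE.
have bP n : P n -> (n <= col F eps)%N.
  by move=> /asboolP[S sS <-]; exact: separated_card_le sS (colP F e0).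
case: (ex_maxnP exP bP) => n /asboolP[S sS cS] maxn.
apply: (@le_trans _ _ (#|` S|%:R)%:E); last by apply: ereal_sup_ubound; exists S.
rewrite lee_fin ler_nat; apply: mincol_le.
have near_S x : exists2 a, a \in S & close F eps a x.
  apply: contrapT => /forall2NP far.
  have farS a : a \in S -> exists2 s, s \in F & eps < mdist (alpha s a) (alpha s x).
    move=> aS; apply: contrapT => /forall2NP H; case: (far a) => //; apply=> s sF.
    by rewrite leNgt; apply/negP; case: (H s).
  have xS : x \notin S.
    by apply/negP => /farS[s _]; rewrite mdistxx ltNge (ltW e0).
  suff /maxn : P #|` (x |` S)%fset| by rewrite cardfsU1 xS cS add1n ltnn.
  apply/asboolP; exists (x |` S)%fset => // y z; rewrite !inE.
  move=> /predU1P[->|yS] /predU1P[->|zS]; rewrite ?eqxx // => nyz.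
  + by have [s sF H] := farS z zS; exists s; rewrite // metric_sym.
  + exact: farS.
  + exact: sS.
have /choice[f Hf] : forall x, exists a, a \in S /\ close F eps a x.
  by move=> x; have [a] := near_S x; exists a.
have fS x : (index (f x) (enum_fset S) < #|` S|)%N.
  by rewrite index_mem; case: (Hf x).
exists (fun x => Ordinal (fS x)) => x y [] e s sF.
have fxy : f x = f y.
  have [fxS _] := Hf x; have [fyS _] := Hf y.
  by rewrite -(nth_index (f x) fxS) e nth_index.
have [_ /(_ s sF) h1] := Hf x; have [_ /(_ s sF) h2] := Hf y.
rewrite -fxy in h2; rewrite metric_sym in h1.
have := metric_triangle (alpha s x) (alpha s (f x)) (alpha s y); lra.
Qed.

End BowenEntropy.

Section Folner.
Variables (R : realType) (G : groupType).
Local Open Scope ring_scope.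

Lemma folner_almost_inv (F : nat -> {fset G}) (K : {fset G}) (d : R) :
  left_Folner R F -> 0 < d -> \forall n \near \oo, almost_inv K d (F n).
Proof.
move=> [F0 cF] d0.
(* Induction on a list containing [K]: half of [d] goes to one element [t], whose boundary lies in
   the symmetric difference of [F n] and [t^-1 F n]. *)
suff H (s : seq G) : forall d : R, 0 < d -> \forall n \near \oo,
    forall K : {fset G}, {subset K <= s} -> almost_inv K d (F n).
  by apply: filterS (H (enum_fset K) d d0) => n; apply.
elim: s => [|t s IH] {}d {}d0.
  apply: nearW => n {}K sK; rewrite /almost_inv.
  have -> : bdry K (F n) = fset0.
    by apply/fsetP => x; rewrite in_fset0; apply/bdryP => -[t /sK].
  by rewrite cardfs0 mulr_ge0 // ltW.
have d2 : 0 < d / 2 by rewrite divr_gt0.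
have {}IH := IH _ d2.
have := cF t^-1%g => /cvgrPdist_le /(_ _ d2) Ft.
near=> n => {}K sK.
have H1 : almost_inv (K `\ t)%fset (d / 2) (F n).
  have : forall K : {fset G}, {subset K <= s} -> almost_inv K (d / 2) (F n) by near: n.
  by apply=> x; rewrite !inE => /andP[/negbTE xt /sK]; rewrite inE xt.
rewrite /almost_inv in H1 *.
have FnP : 0 < #|` F n|%:R :> R by rewrite ltr0n cardfs_gt0.
have H2 : #|` bdry [fset t]%fset (F n)|%:R <= d / 2 * #|` F n|%:R.
  rewrite -ler_pdivrMr //.
  have : `|0 - #|` ([fset (t^-1 * x)%g | x in F n] `\` F n `|`
     F n `\` [fset (t^-1 * x)%g | x in F n])%fset|%:R / #|` F n|%:R : R| <= d / 2.
    by near: n.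
  rewrite sub0r normrN ger0_norm // => H.
  apply: le_trans H; rewrite ler_pM2r ?invr_gt0 // ler_nat fsubset_leq_card //.
  apply/fsubsetP => x /bdryP[_ /fset1P ->].
  have -> : (t * x \in F n)%g = (x \in [fset (t^-1 * y)%g | y in F n]%fset).
    apply/idP/imfsetP => [xF|[y /= yF ->]]; last by rewrite mulVKg.
    by exists (t * x)%g; rewrite ?mulKg.
  by rewrite !(in_fsetU, in_fsetD); do 2 case: (_ \in _).
apply: (@le_trans _ _ (#|` bdry [fset t]%fset (F n)|%:R + #|` bdry (K `\ t)%fset (F n)|%:R)).
  rewrite -natrD ler_nat; apply: leq_trans (leq_card_fsetU _ _).
  apply: fsubset_leq_card; apply/fsubsetP => x /bdryP[u uK H].
  rewrite in_fsetU; apply/orP; have [ut|ut] := eqVneq u t; [left|right]; apply/bdryP.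
    by exists t; rewrite ?inE // -ut.
  by exists u; rewrite // !inE ut.
lra.
Unshelve. all: by end_near. Qed.

End Folner.

Section Limsup.
Variable R : realType.
Local Open Scope ereal_scope.

Lemma limn_esup_le (u : nat -> \bar R) l :
  (\forall n \near \oo, u n <= l) -> limn_esup u <= l.
Proof.
move=> ul; apply: (@le_trans _ _ (ereal_sup (u @` [set n | u n <= l]))).
  by apply: ereal_inf_lbound; exists [set n | u n <= l].
by apply: ge_ereal_sup => _ [n /= un <-].
Qed.

Lemma limn_esup_lt (u : nat -> \bar R) l :
  limn_esup u < l -> \forall n \near \oo, u n < l.
Proof.
move=> /ereal_inf_lt[_ [V FV <-] Vl]; apply: filterS FV => n Vn.
by apply: le_lt_trans Vl; apply: ereal_sup_ubound; exists n.
Qed.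

End Limsup.

Section EntropyBounds.
Variables (R : realType) (G : groupType) (X : metricType R) (alpha : G -> X -> X).
Variable F : nat -> {fset G}.
Hypothesis cX : compact [set: X].
Hypothesis act : action_by_homeo alpha.
Hypothesis FF : left_Folner R F.
Local Open Scope ring_scope.

(** On the empty space [sep] is 0 and [lne] of it is [-oo]; a nonempty space has nonnegative entropy
    by [htop_ge0]. *)
Lemma htop_empty : ~ (exists x : X, True) -> htop alpha F = -oo%E.
Proof.
move=> nX; apply/eqP; rewrite -leeNy_eq; apply: ge_ereal_sup => _ [eps _ <-].
apply: limn_esup_le; apply: nearW => n.
have -> : sep alpha (F n) eps = 0%E.
  apply/eqP; rewrite eq_le; apply/andP; split.
    apply: ge_ereal_sup => _ [S _ <-]; have [->|/fset0Pn[x]] := eqVneq S fset0.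
      by rewrite cardfs0.
    by case: nX; exists x.
  apply: ereal_sup_ubound; exists fset0; last by rewrite cardfs0.
  by move=> x; case: nX; exists x.
rewrite le0_lneNy // gt0_muleNy // lte_fin invr_gt0 ltr0n cardfs_gt0.
by case: FF.
Qed.

Variable x0 : X.

Lemma htop_ge0 : (0 <= htop alpha F)%E.
Proof.
apply: (@le_trans _ _ (limn_esup
      (fun n => ((#|` F n|%:R)^-1)%:E * lne (sep alpha (F n) 1))%E)); last first.
  by apply: ereal_sup_ubound; exists 1 => //=; rewrite ltr01.
apply: le_ereal_inf_tmp => _ [V [N _ NV] <-].
apply: (@le_trans _ _ (((#|` F N|%:R)^-1)%:E * lne (sep alpha (F N) 1))%E).
  by rewrite mule_ge0 // lne_ge0; exact: sep_ge1.
by apply: ereal_sup_ubound; exists N => //; apply: NV => /=.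
Qed.

Lemma htop_le (h : R) :
  (forall eps eta : R, 0 < eps -> 0 < eta ->
    \forall n \near \oo, logcol alpha eps (F n) <= (h + eta) * #|` F n|%:R) ->
  (htop alpha F <= h%:E)%E.
Proof.
move=> H; apply: ge_ereal_sup => _ [eps /= eps0 <-].
apply/lee_addgt0Pr => eta eta0; apply: limn_esup_le; apply: filterS (H _ _ eps0 eta0).
move=> n Hn; have FnP : 0 < #|` F n|%:R :> R by rewrite ltr0n cardfs_gt0; case: FF.
apply: (@le_trans _ _ (((#|` F n|%:R)^-1)%:E * (logcol alpha eps (F n))%:E)%E).
  apply: lee_wpmul2l; first by rewrite lee_fin invr_ge0 ltW.
  rewrite -lne_EFin ?ltr0n ?col_gt0 // lee_lne ?sep_le_col //; rewrite in_itv /= leey andbT.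
    by apply: le_trans (sep_ge1 _ x0 _ _); rewrite lee_fin.
  by rewrite lee_fin.
by rewrite -EFinM -EFinD lee_fin mulrC ler_pdivrMr.
Qed.

Lemma logcol_le_htop (h eps eta : R) : (htop alpha F <= h%:E)%E -> 0 < eps -> 0 < eta ->
  \forall n \near \oo, logcol alpha eps (F n) <= (h + eta) * #|` F n|%:R.
Proof.
move=> Hh eps0 eta0; have e2 : 0 < eps / 2 by rewrite divr_gt0.
have : (limn_esup (fun n => ((#|` F n|%:R)^-1)%:E * lne (sep alpha (F n) (eps / 2)))
    < (h + eta)%:E)%E.
  apply: (@le_lt_trans _ _ h%:E); last by rewrite lte_fin ltrDl.
  by apply: le_trans Hh; apply: ereal_sup_ubound; exists (eps / 2).
move=> /limn_esup_lt; apply: filterS => n Hn.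
have FnP : 0 < #|` F n|%:R :> R by rewrite ltr0n cardfs_gt0; case: FF.
rewrite -ler_pdivrMr // mulrC -lee_fin EFinM; apply: le_trans (ltW Hn).
apply: lee_wpmul2l; first by rewrite lee_fin invr_ge0 ltW.
have := col_le_sep cX act (F n) e2; rewrite [2 * _]mulrC divfK // => H.
rewrite -lne_EFin ?ltr0n ?col_gt0 // lee_lne //; rewrite in_itv /= leey andbT.
  by rewrite lee_fin.
by apply: le_trans (sep_ge1 _ x0 _ _); rewrite lee_fin.
Qed.

End EntropyBounds.

(** * Orbit equivalence *)

Section LocallyConstant.
Variables (R : realType) (X : metricType R).

Definition loc_const T (f : X -> T) := local_rel (fun x y => f x = f y).

Lemma loc_const_comp T (f : X -> T) (h : X -> X) :
  continuous h -> loc_const f -> loc_const (f \o h).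
Proof.
move=> ch Hf x; have [U Ux HU] := Hf (h x).
by exists (h @^-1` U); [exact: ch|move=> y z; exact: HU].
Qed.

Lemma loc_const_op T1 T2 T3 (op : T1 -> T2 -> T3) (f : X -> T1) (g : X -> T2) :
  loc_const f -> loc_const g -> loc_const (fun x => op (f x) (g x)).
Proof.
move=> Hf Hg x; have [U Ux HU] := local_relI Hf Hg x.
by exists U => // y z Uy Uz; have [-> ->] := HU y z Uy Uz.
Qed.

Lemma loc_const_subst S T (k : X -> S) (f : S -> X -> T) :
  loc_const k -> (forall s, loc_const (f s)) -> loc_const (fun x => f (k x) x).
Proof.
move=> Hk Hf x; have [U Ux HU] := local_relI Hk (Hf (k x)) x.
exists U => // y z Uy Uz; have Ux' := nbhs_singleton Ux.
have [-> _] := HU y x Uy Ux'; have [-> _] := HU z x Uz Ux'.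
by have [_] := HU y z Uy Uz.
Qed.

(** Carries cocycle identities from points with trivial stabilizer, where they can be read off the
    action, to all points. *)
Lemma loc_const_dense T (D : set X) (f g : X -> T) : dense D ->
  loc_const f -> loc_const g -> (forall x, D x -> f x = g x) -> forall x, f x = g x.
Proof.
move=> dD Hf Hg fg x; have [U Ux HU] := local_relI Hf Hg x.
have [|y [Uy Dy]] := dD (U°) _ (@open_interior _ U); first by exists x.
have [-> ->] := HU x y (nbhs_singleton Ux) (interior_subset Uy).
exact: fg.
Qed.

Lemma loc_const_range (T : eqType) (f : X -> T) : compact [set: X] -> loc_const f ->
  exists s : seq T, forall x, f x \in s.
Proof.
move=> cX /(local_rel_colorable cX) [n [c Hc]].
have [[x1 _]|nX] := pselect (exists x : X, True); last first.
  by exists [::] => x; case: nX; exists x.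
have /choice[g Hg] : forall i : 'I_n, exists t : T, forall x, c x = i -> f x = t.
  move=> i; have [[x <-]|nx] := pselect (exists x, c x = i).
    by exists (f x) => y; exact: Hc.
  by exists (f x1) => x cx; case: nx; exists x.
exists [seq g i | i <- enum 'I_n] => x; rewrite (Hg (c x)) //.
by apply: map_f; rewrite mem_enum.
Qed.

Lemma continuous_discrete_section (G H : choiceType) (f : G * X -> H) g :
  continuous (f : discrete_topology G * X -> discrete_topology H) ->
  loc_const (fun x => f (g, x)).
Proof.
move=> cf x; have := cf (g, x) [set f (g, x)].
have N : nbhs (f (g, x) : discrete_topology H) [set f (g, x)].
  by rewrite nbhs_principalE.
move=> /(_ N) [[A B] /= [Ag Bx] AB]; exists B => // y z By Bz.
have Agg : A g by exact: (@nbhs_singleton (discrete_topology G)) Ag.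
have /= -> := AB (g, y) (conj Agg By).
by have /= -> := AB (g, z) (conj Agg Bz).
Qed.

End LocallyConstant.

Section GeneratingSets.
Variable G : groupType.
Implicit Types T A : {fset G}.

Lemma generatesS T T' : (T `<=` T')%fset -> generates T -> generates T'.
Proof.
move=> TT gT A A1 AT; apply: gT => // t x tT; apply: AT; exact: (fsubsetP TT).
Qed.

(** A nonempty closed set contains all [x * a], too much for a finite set. Finite sets are compared
    below by showing that a difference is closed. *)
Lemma generates_closed T A : generates T -> infinite_set [set: G] ->
  (forall t x, t \in T -> x \in A -> (t * x)%g \in A) -> A = fset0.
Proof.
move=> gT inf cl; apply/eqP; apply: contraT => /fset0Pn[a aA]; case: inf.
have H x : (x * a)%g \in A.
  by apply: (gT (fun x => (x * a)%g \in A)) => [|t y tT]; rewrite ?mul1g // -mulgA; exact: cl.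
apply: (@sub_finite_set _ _ [set` A]); last exact: finite_fset.
by move=> x _ /=; rewrite -(mulgVK a x) H.
Qed.

Lemma symmetric_closure A : exists T, [/\ (A `<=` T)%fset, 1%g \in T &
  forall t, t \in T -> t^-1%g \in T].
Proof.
exists (1%g |` (A `|` [fset x^-1%g | x in A]))%fset; split.
- by apply/fsubsetP => x xA; rewrite !in_fsetU xA orbT.
- by rewrite in_fsetU in_fset1 eqxx.
- move=> t; rewrite !in_fsetU in_fset1 => /or3P[/eqP ->|tA|/imfsetP[x /= xA ->]].
  + by rewrite invg1 in_fset1 eqxx.
  + by apply/orP; right; apply/orP; right; apply/imfsetP; exists t.
  + by rewrite invgK xA orbT.
Qed.

Lemma finitely_generated_generates : finitely_generated G ->
  exists T, [/\ 1%g \in T, (forall t, t \in T -> t^-1%g \in T) & generates T].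
Proof.
move=> [S [fS gS]]; have /finite_fsetP[T0 ST0] := fS.
have [T [T0T T1 TV]] := symmetric_closure T0.
exists T; split => // A A1 AT x.
have gx : generated_subgroup S x by rewrite gS.
(* [A] is only closed under [T], so the subgroup induction runs on the elements that preserve [A]
   together with their inverses. *)
pose H := [set x | forall y, A y -> A (x * y)%g /\ A (x^-1 * y)%g].
suff /(_ 1%g A1) [] : H x by rewrite mulg1.
apply: gx.
split; first split.
  - by move=> y Ay; rewrite invg1 mul1g.
  - move=> u v Hu Hv y Ay; rewrite invgM -!mulgA.
    by split; [apply Hu; apply Hv|apply Hv; apply Hu].
  - by move=> u Hu y /Hu[]; rewrite invgK.
  move=> s Ss y Ay; have sT : s \in T by apply: (fsubsetP T0T); move: Ss; rewrite ST0.
  by split; apply: AT => //; exact: TV.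
Qed.

End GeneratingSets.

(** * The bijections [orbmap x] and the transfer of coloring bounds *)

Section OrbitEquivalence.
Variables (R : realType) (G L : groupType) (X Y : metricType R).
Variables (alpha : G -> X -> X) (beta : L -> Y -> Y).
Variables (Phi : X -> Y) (Psi : Y -> X) (kap : G * X -> L) (lam : L * Y -> G).
Hypotheses (cX : compact [set: X]) (cY : compact [set: Y]).
Hypotheses (actX : action_by_homeo alpha) (actY : action_by_homeo beta).
Hypotheses (freeX : topologically_free alpha) (freeY : topologically_free beta).
Hypotheses (PhiK : cancel Phi Psi) (PsiK : cancel Psi Phi).
Hypotheses (cPhi : continuous Phi) (cPsi : continuous Psi).
Hypothesis ckap : continuous (kap : discrete_topology G * X -> discrete_topology L).
Hypothesis clam : continuous (lam : discrete_topology L * Y -> discrete_topology G).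
Hypothesis kapE : forall t x, Phi (alpha t x) = beta (kap (t, x)) (Phi x).
Hypothesis lamE : forall h y, Psi (beta h y) = alpha (lam (h, y)) (Psi y).

Definition orbmap (x : X) (e : L) : G := lam (e, Phi x).

Lemma orbmapE x e : Phi (alpha (orbmap x e) x) = beta e (Phi x).
Proof. by rewrite /orbmap -{2}(PhiK x) -lamE PsiK. Qed.

Lemma free_inj x s t : (forall u, alpha u x = x -> u = 1%g) ->
  alpha s x = alpha t x -> s = t.
Proof.
have [a1 aM _] := actX; move=> fx e; apply: (mulgI t^-1%g); rewrite mulVg.
by apply: fx; rewrite aM e -aM mulVg a1.
Qed.

Lemma free_injY y s t : (forall u, beta u y = y -> u = 1%g) ->
  beta s y = beta t y -> s = t.
Proof.
have [a1 aM _] := actY; move=> fx e; apply: (mulgI t^-1%g); rewrite mulVg.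
by apply: fx; rewrite aM e -aM mulVg a1.
Qed.

Lemma dense_freeY : dense [set x | forall u, beta u (Phi x) = Phi x -> u = 1%g].
Proof.
move=> O [x Ox] oO.
have [||y [Oy fy]] := freeY (O := Psi @^-1` O).
- by exists (Phi x); rewrite /= PhiK.
- by apply: open_comp oO => y _; exact: cPsi.
by exists (Psi y); split => //= u; rewrite PsiK; exact: fy.
Qed.

Lemma orbmap_loc e : loc_const (fun x => orbmap x e).
Proof.
move=> x; have [U Ux HU] := continuous_discrete_section e clam (Phi x).
by exists (Phi @^-1` U); [exact: cPhi|move=> y z; exact: HU].
Qed.

Lemma kap_loc t : loc_const (fun x => kap (t, x)).
Proof. exact: continuous_discrete_section. Qed.

Lemma alpha_cts s : continuous (alpha s).
Proof. by case: actX. Qed.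

Lemma orbmapM x e e' : orbmap x (e' * e)%g = (orbmap (alpha (orbmap x e) x) e' * orbmap x e)%g.
Proof.
move: x; apply: (loc_const_dense freeX); first exact: orbmap_loc.
  apply: loc_const_op; last exact: orbmap_loc.
  apply: (loc_const_subst (f := fun s x => orbmap (alpha s x) e')); first exact: orbmap_loc.
  by move=> s; apply: loc_const_comp (orbmap_loc e'); exact: alpha_cts.
move=> x fx; apply: (free_inj fx); apply: (can_inj PhiK).
have [_ aM _] := actX; have [_ bM _] := actY.
by rewrite orbmapE aM orbmapE orbmapE bM.
Qed.

Lemma orbmap1 x : orbmap x 1%g = 1%g.
Proof.
have [a1 _ _] := actX; have [b1 _ _] := actY.
move: x; apply: (loc_const_dense freeX); first exact: orbmap_loc.
  by move=> x; exists setT => //; exact: filterT.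
by move=> x fx; apply: (free_inj fx); apply: (can_inj PhiK); rewrite orbmapE a1 b1.
Qed.

Lemma orbmapK x : cancel (orbmap x) (fun t => kap (t, x)).
Proof.
(* This identity lives in [L], so it is checked where the stabilizer of [Phi x] under [beta] is
   trivial. *)
move=> e; move: x; apply: (loc_const_dense dense_freeY).
- apply: (loc_const_subst (f := fun s x => kap (s, x))); first exact: orbmap_loc.
  exact: kap_loc.
- by move=> x; exists setT => //; exact: filterT.
- by move=> x fx; apply: (free_injY fx); rewrite -kapE orbmapE.
Qed.

Lemma kapK x : cancel (fun t => kap (t, x)) (orbmap x).
Proof.
move=> t; move: x; apply: (loc_const_dense freeX).
- apply: (loc_const_subst (f := fun s x => orbmap x s)); first exact: kap_loc.
  exact: orbmap_loc.
- by move=> x; exists setT => //; exact: filterT.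
- by move=> x fx; apply: (free_inj fx); apply: (can_inj PhiK); rewrite orbmapE kapE.
Qed.

Lemma orbmap_inj x : injective (orbmap x).
Proof. exact: can_inj (orbmapK x). Qed.

(** A step by [s] in [G] is the image of a step in [L] by a value of [kap] at [s]; these values form
    a finite set by compactness. *)
Lemma orbmap_step x e s :
  (s * orbmap x e)%g = orbmap x (kap (s, alpha (orbmap x e) x) * e)%g.
Proof. by rewrite orbmapM kapK. Qed.

Definition window x (E : {fset L}) : {fset G} := [fset orbmap x e | e in E]%fset.

Lemma in_window x E e : (orbmap x e \in window x E) = (e \in E).
Proof.
apply/imfsetP/idP => [[e' /= e'E /orbmap_inj ->] //|eE]; by exists e.
Qed.

Lemma card_window x E : #|` window x E| = #|` E|.
Proof. by rewrite card_imfset //; exact: orbmap_inj. Qed.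

Definition same_pattern (l : seq L) x y := forall e, e \in l -> orbmap x e = orbmap y e.

Section Patterns.
Variables (S : {fset G}) (T K E : {fset L}) (l : seq L).
Hypotheses (infG : infinite_set [set: G]) (infL : infinite_set [set: L]).
Hypotheses (genS : generates S) (genT : generates T).
Hypothesis TV : forall t, t \in T -> t^-1%g \in T.
Hypothesis TK : (T `<=` K)%fset.
Hypothesis kapK' : forall s x, s \in S -> kap (s, x) \in K.
Hypothesis bdl : {subset bdry K E <= l}.

Lemma interior_step e t : e \notin l -> t \in K -> (t * e \in E)%g = (e \in E).
Proof.
move=> el tK; apply/eqP; apply: contraT => H.
by case/negP: el; apply: bdl; apply/bdryP; exists t.
Qed.

(* The difference of two windows is invariant under [S]: steps from the
   interior stay inside, and the boundaries agree. *)
Lemma window_sub x y : same_pattern l x y -> (window x E `<=` window y E)%fset.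
Proof.
move=> xy; rewrite -fsetD_eq0; apply/eqP; apply: (generates_closed genS infG).
move=> s g sS; rewrite !in_fsetD => /andP[gy gx].
move: (gx) => /imfsetP[e /= eE ge]; have ge' := kapK y g; simpl in ge'.
set e' := kap (g, y) in ge'.
have e'E : e' \notin E by move: gy; rewrite -ge' in_window.
have el : e \notin l.
  by apply/negP => /xy H; move: gy; rewrite ge H in_window eE.
have e'l : e' \notin l.
  by apply/negP => /xy; rewrite ge' ge => /orbmap_inj H; rewrite H eE in e'E.
apply/andP; split.
  by rewrite -ge' orbmap_step in_window interior_step //; exact: kapK'.
by rewrite ge orbmap_step in_window interior_step //; exact: kapK'.
Qed.

Lemma window_eq x y : same_pattern l x y -> window x E = window y E.
Proof.
move=> xy; apply/eqP; rewrite eqEfsubset !window_sub // => e el.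
by rewrite xy.
Qed.

Lemma almost_inv_window (K' : {fset G}) (d : R) x : (K' `<=` S)%fset ->
  ((size l)%:R <= d * #|` E|%:R)%R -> almost_inv K' d (window x E).
Proof.
move=> K'S ld; rewrite /almost_inv card_window; apply: le_trans ld.
rewrite ler_nat -(size_map (orbmap x)); apply: uniq_leq_size; first exact: fset_uniq.
move=> g /bdryP[s sK']; have <- := kapK x g; rewrite orbmap_step !in_window => H.
apply: map_f; apply: bdl; apply/bdryP; exists (kap (s, alpha (orbmap x (kap (g, x))) x)) => //.
by apply: kapK'; exact: (fsubsetP K'S).
Qed.

(** The points of [E] where the two maps differ form a set closed under [T]: such an [e] is off [l],
    so [t * e] is in [E], and agreement at [t * e] would return to [e] through the step [t^-1],
    since closeness there makes the two maps agree on [T]. *)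
Lemma orbmap_eq_of_close (d : R) x y :
  (forall u v, (mdist u v <= d)%R -> forall t, t \in T -> orbmap u t = orbmap v t) ->
  same_pattern l x y -> close alpha (window x E) d x y ->
  forall e, e \in E -> orbmap x e = orbmap y e.
Proof.
move=> dT xy cl e eE.
suff D0 : [fset e in E | orbmap x e != orbmap y e]%fset = fset0.
  apply/eqP; apply: contraT => H.
  have : e \in [fset e in E | orbmap x e != orbmap y e]%fset by rewrite !inE eE.
  by rewrite D0 in_fset0.
apply: (generates_closed genT infL) => t {eE}e tT; rewrite !inE => /andP[eE ne].
have el : e \notin l by apply: contra ne => /xy ->.
have teE : (t * e)%g \in E by rewrite interior_step //; exact: (fsubsetP TK).
rewrite teE /=; apply: contra ne => /eqP H.
have -> : e = (t^-1 * (t * e))%g by rewrite mulKg.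
rewrite !(orbmapM _ (t * e)%g) -H; apply/eqP; congr (_ * _)%g.
by apply: dT; [apply: cl; rewrite in_window|exact: TV].
Qed.

End Patterns.

(** Once the value at a vertex [y] is fixed, the cocycle identity reads the value at [t * y] off the
    [C]-coloring of the translated point, so each vertex costs a factor [C]. *)
Lemma pattern_count (K : {fset L}) C l : (0 < C)%N ->
  colorable C (fun x y => forall t, t \in K -> orbmap x t = orbmap y t) ->
  grown K l -> colorable (C ^ size l) (same_pattern l).
Proof.
move=> C0 cC; elim: l => [|e l IH] /=.
  by move=> _; rewrite expn0; exists (fun=> ord0) => x y _ t.
move=> [/IH cl He]; rewrite expnSr; apply: (colorable_dep cl) => x0.
have [e1|[t [y [tK yl ->]]]] := He.
  have [c _] := cC; exists c => u v _ hu hv e'; rewrite inE => /predU1P[->|e'l].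
    by rewrite e1 !orbmap1.
  by rewrite -hu // -hv.
have [c Hc] := colorable_comp (alpha (orbmap x0 y)) cC.
exists c => u v /Hc H hu hv e'; rewrite inE => /predU1P[->|e'l].
  by rewrite !orbmapM -(hu _ yl) -(hv _ yl) H.
by rewrite -hu // -hv.
Qed.

Lemma kap_range (S : {fset G}) : exists A : {fset L},
  forall s x, s \in S -> kap (s, x) \in A.
Proof.
have [r Hr] : exists r : seq L, forall s x, s \in enum_fset S -> kap (s, x) \in r.
  elim: (enum_fset S) => [|s S' [r Hr]]; first by exists [::].
  have [r' Hr'] := loc_const_range cX (kap_loc s).
  exists (r' ++ r) => u x; rewrite inE mem_cat => /predU1P[->|/Hr ->].
    by rewrite Hr'.
  by rewrite orbT.
by exists [fset u in r]%fset => s x sS; rewrite inE /= Hr.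
Qed.

Local Open Scope ring_scope.

Lemma logcol_transfer (x0 : X) (h : R) :
  finitely_generated G -> finitely_generated L -> infinite_set [set: G] ->
  ~ virtually_cyclic L -> 0 <= h ->
  (forall (K : {fset L}) (d : R), 0 < d -> exists2 D, D != fset0 & almost_inv K d D) ->
  (forall eps eta (K : {fset G}) (d : R), 0 < eps -> 0 < eta -> 0 < d ->
    exists D, [/\ D != fset0, almost_inv K d D & logcol alpha eps D <= (h + eta) * #|` D|%:R]) ->
  forall eps eta (K : {fset L}) (d : R), 0 < eps -> 0 < eta -> 0 < d ->
    exists E, [/\ E != fset0, almost_inv K d E & logcol beta eps E <= (h + eta) * #|` E|%:R].
Proof.
move=> fgG fgL infG nvcL h0 folL HX eps eta K d eps0 eta0 d0.
have infL := infinite_not_virtually_cyclic nvcL.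
have [S0 [_ _ genS0]] := finitely_generated_generates fgG.
have [T [_ TV genT]] := finitely_generated_generates fgL.
(* At this scale [Phi] moves close points to [eps]-close points and [orbmap] agrees on the
   generators [T]. *)
have [e' e'0 He'] : exists2 e', 0 < e' & forall u v, mdist u v <= e' ->
    mdist (Phi u) (Phi v) <= eps /\ forall t, t \in T -> orbmap u t = orbmap v t.
  apply: (lebesgue_number cX); apply: local_relI; last first.
    by apply: (@local_rel_all _ _ _ (enum_fset T)
      (fun t x y => orbmap x t = orbmap y t)) => t _; exact: orbmap_loc.
  move=> x; exists (Phi @^-1` ball (Phi x) (eps / 2)).
    by apply: cPhi; apply: nbhsx_ballx; rewrite divr_gt0.
  move=> y z; rewrite /= !ballEmdist /= => h1 h2.
  have := metric_triangle (Phi y) (Phi x) (Phi z).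
  by rewrite (metric_sym (Phi y) (Phi x)); lra.
(* The invariance [K'], [d'] required of windows is fixed before [E] is chosen. *)
have [|||K' [d' [d'0 HK']]] :=
  @logcol_ornstein_weiss R G X alpha cX actX x0 e' (h + eta / 4) (eta / 4) e'0.
- lra.
- lra.
- by move=> K1 d1 d10; apply: HX => //; lra.
pose S := (S0 `|` K')%fset.
have [A HA] := kap_range S.
(* [T] generates, [K] is the requested invariance, and [A] contains the displacements of steps by
   [S], so a tree through the [K2]-boundary controls windows as well. *)
have [K2 [AK2 K21 K2V]] := symmetric_closure (T `|` K `|` A)%fset.
have TK2 : (T `<=` K2)%fset by apply: fsubset_trans AK2; rewrite -fsetUA fsubsetUl.
have KK2 : (K `<=` K2)%fset.
  by apply: fsubset_trans AK2; apply: fsubset_trans (fsubsetUl _ _); exact: fsubsetUr.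
have kapK2 s x : s \in S -> kap (s, x) \in K2.
  by move=> sS; apply: (fsubsetP AK2); rewrite in_fsetU HA ?orbT.
have [C cC] : exists C, colorable C
    (fun x y => forall t, t \in K2 -> orbmap x t = orbmap y t).
  apply: (local_rel_colorable cX); apply: (@local_rel_all _ _ _ (enum_fset K2)
      (fun t x y => orbmap x t = orbmap y t)) => t _; exact: orbmap_loc.
have C0 := colorable_gt0 x0 cC.
have lnC : 0 <= ln C%:R :> R by rewrite ln_ge0 // ler1n.
(* The patterns cost [size l * ln C], at most [eta / 2 * |E|]; the summand 1 keeps the denominator
   positive when [C] is 1. *)
pose q := eta / (2 * (ln C%:R + 1)).
have q0 : 0 < q by rewrite divr_gt0 //; lra.
have qE : q * ln C%:R <= eta / 2.
  have : q * (2 * (ln C%:R + 1)) = eta by rewrite /q mulfVK // gt_eqF //; lra.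
  nra.
pose del := Num.min (Num.min d d') q.
have del0 : 0 < del by rewrite !lt_min d0 d'0 q0.
have [E [l [E0 gl bdl sl]]] := 
  sparse_boundary_tree K21 K2V (generatesS TK2 genT) nvcL del0 folL.
have Ep : 0 <= #|` E|%:R :> R by [].
have [sd sd' sq] : [/\ (size l)%:R <= d * #|` E|%:R, (size l)%:R <= d' * #|` E|%:R &
    (size l)%:R <= q * #|` E|%:R].
  by split; apply: le_trans sl _; rewrite ler_wpM2r // !ge_min lexx ?orbT.
exists E; split => //.
  apply: le_trans sd; rewrite ler_nat; apply: uniq_leq_size; first exact: fset_uniq.
  by move=> x /(fsubsetP (bdryS E KK2)) /bdl.
pose M := Num.truncn (expR ((h + eta / 2) * #|` E|%:R)).
have expp := expR_ge0 ((h + eta / 2) * #|` E|%:R).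
have M0 : (0 < M)%N.
  by rewrite Num.Theory.truncn_gt0 -[leLHS]expR0 ler_expR mulr_ge0 //; lra.
have genS : generates S by apply: generatesS genS0; rewrite fsubsetUl.
(* Points are colored by their pattern first; all points of one pattern share a window, which a
   single coloring with [M] colors then serves. *)
have cE : colorable (C ^ size l * M) (fun u v => close beta E eps (Phi u) (Phi v)).
  apply: (colorable_dep (pattern_count C0 cC gl)) => x1.
  have cM : colorable M (close alpha (window x1 E) e').
    apply: colorable_le (colP cX actX _ e'0).
    have c0 := col_gt0 cX actX x0 (window x1 E) e'0.
    rewrite Num.Theory.truncn_ge_nat // -[leLHS]lnK ?posrE ?ltr0n // ler_expR.
    have iw : almost_inv K' d' (window x1 E).
      exact: (almost_inv_window kapK2 bdl x1 (fsubsetUr S0 K') sd').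
    have := HK' _ iw; rewrite card_window /logcol; lra.
  have [c Hc] := cM; exists c => u v /Hc cl xu xv e eE.
  have uv : same_pattern l u v by move=> t tl; rewrite -xu // xv.
  have wu : window x1 E = window u E by apply: (window_eq infG genS kapK2 bdl).
  rewrite wu in cl.
  have oe : forall e, e \in E -> orbmap u e = orbmap v e.
    by apply: (orbmap_eq_of_close infL genT TV TK2 bdl _ uv cl) => a b /He'[].
  rewrite -!orbmapE -(oe e eE).
  have ue : orbmap u e \in window u E by rewrite in_window.
  by have [] := He' _ _ (cl _ ue).
have [c Hc] := colorable_comp Psi cE.
have cE' : colorable (C ^ size l * M) (close beta E eps).
  by exists c => x y /Hc; rewrite !PsiK.
have CM0 : (0 < C ^ size l * M)%N by rewrite muln_gt0 expn_gt0 C0.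
apply: le_trans (le_logcol CM0 cE') _.
rewrite natrM natrX lnM ?posrE ?exprn_gt0 ?ltr0n // lnXn ?ltr0n //.
have lnM : ln M%:R <= (h + eta / 2) * #|` E|%:R.
  by rewrite -[leRHS]expRK ler_ln ?posrE ?ltr0n ?expR_gt0 // Num.Theory.truncn_le.
rewrite -(mulr_natl (ln _)).
have := ler_wpM2r lnC sq; have := ler_wpM2r Ep qE.
lra.
Qed.

(** The sets supplied by [logcol_transfer] need not belong to the sequence [E]; a second
    Ornstein-Weiss estimate, now for [beta], extends their bound to all sufficiently invariant
    sets. *)
Lemma htop_le_htop (F : nat -> {fset G}) (E : nat -> {fset L}) :
  finitely_generated G -> finitely_generated L ->
  ~ virtually_cyclic G -> ~ virtually_cyclic L ->
  left_Folner R F -> left_Folner R E -> (htop beta E <= htop alpha F)%E.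
Proof.
move=> fgG fgL nvcG nvcL FF FE.
have [[x0 _]|nX] := pselect (exists x : X, True); last first.
  have nY : ~ exists y : Y, True by move=> [y _]; apply: nX; exists (Psi y).
  by rewrite (htop_empty beta FE nY) leNye.
have := htop_ge0 alpha F x0; case hE : (htop alpha F) => [h| |];
  [|by move=> _; rewrite leey|by rewrite leeNy_eq].
rewrite lee_fin => h0.
have hF : (htop alpha F <= h%:E)%E by rewrite hE.
have infG := infinite_not_virtually_cyclic nvcG.
apply: (htop_le cY actY FE (Phi x0)) => eps eta eps0 eta0.
have e2 : 0 < eta / 2 by rewrite divr_gt0.
have [|K [d [d0 HK]]] := @logcol_ornstein_weiss R L Y beta cY actY (Phi x0) eps
    (h + eta / 2) (eta / 2) eps0 (addr_ge0 h0 (ltW e2)) e2.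
  move=> K d d0; apply: (@logcol_transfer x0 h) => //.
    move=> T q q0; have [n Hn] := filter_ex (folner_almost_inv T FE q0).
    by exists (E n) => //; case: FE.
  move=> e q T t e0 q0 t0.
  have [n [Hn1 Hn2]] := filter_ex (filterI (folner_almost_inv T FF t0)
    (logcol_le_htop cX actX FF x0 hF e0 q0)).
  by exists (F n); split => //; case: FF.
by apply: filterS (folner_almost_inv K FE d0) => n /HK; rewrite -addrA -splitr.
Qed.

End OrbitEquivalence.

Theorem theorem7p5 (R : realType) (Gamma Lambda : groupType)
  (X Y : metricType R)
  (alpha : Gamma -> X -> X) (beta : Lambda -> Y -> Y)
  (F : nat -> {fset Gamma}) (E : nat -> {fset Lambda}) :
  finitely_generated Gamma -> amenable R Gamma -> ~ virtually_cyclic Gamma ->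
  finitely_generated Lambda -> amenable R Lambda -> ~ virtually_cyclic Lambda ->
  compact [set: X] -> compact [set: Y] ->
  action_by_homeo alpha -> action_by_homeo beta ->
  topologically_free alpha -> topologically_free beta ->
  continuously_orbit_equivalent alpha beta ->
  left_Folner R F -> left_Folner R E ->
  htop alpha F = htop beta E.
Proof.
move=> fgG _ nvcG fgL _ nvcL cX cY actX actY freeX freeY.
move=> [Phi [Psi [kap [lam [[PhiK PsiK cPhi cPsi] ckap clam kapE lamE]]]]] FF FE.
apply/eqP; rewrite eq_le; apply/andP; split.
  exact: (htop_le_htop cY cX actY actX freeY freeX PsiK PhiK cPsi cPhi clam ckap lamE kapE).
exact: (htop_le_htop cX cY actX actY freeX freeY PhiK PsiK cPhi cPsi ckap clam kapE lamE).
Qed.
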